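(* Let $p\ge 1$ and let $f$ be a $\mathbb C^{p\times p}$-valued symmetric discrete analytic function in the quarter plane $\Lambda_{++}=\mathbb N_0+i\mathbb N_0$, with $f(m,n)=f(m+in)$. Then all the finite section block matrices $F_N=(f(m,n))_{m,n=0}^{N}$, $N=0,1,2,\ldots$, are non-negative (positive semidefinite) if and only if there exists a finite positive $\mathbb C^{p\times p}$-valued measure $M$ on $[0,2\pi]$ such that $$f(m,n)=\frac{1}{2\pi}\int_0^{2\pi}(\sqrt{2}e^{-it}-i)^m(\sqrt{2}e^{it}+i)^n\,dM(t),\qquad m,n=0,1,\ldots$$
   Context: $\mathbb N_0=\{0,1,2,\ldots\}$. A function $f:\Lambda_{++}\to\mathbb C^{p\times p}$, written $f(m,n)=f(m+in)$, is discrete analytic if $f(m,n)+if(m+1,n)-if(m,n+1)-f(m+1,n+1)=0$ for all $m,n\in\mathbb N_0$. It is symmetric if $f(m,0)=f(0,m)^*$ for all $m\in\mathbb N_0$ (equivalently, for discrete analytic $f$, $f(m,n)=f(n,m)^*$ for all $m,n\in\mathbb N_0$). $F_N$ is the $(N+1)p\times(N+1)p$ block matrix whose $(m,n)$ block is $f(m,n)$. *)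

(* Defs.v *)
From HB Require Import structures.
From mathcomp Require Import all_boot all_order all_algebra.
From mathcomp Require Export complex.
From mathcomp Require Import all_classical all_reals all_analysis.

Set Implicit Arguments.
Unset Strict Implicit.
Unset Printing Implicit Defensive.

Import Order.TTheory GRing.Theory Num.Theory.
Import numFieldNormedType.Exports.

Local Open Scope ring_scope.
Local Open Scope complex_scope.
Local Open Scope sesquilinear_scope.
Local Open Scope classical_set_scope.

(* In the order of R[i], 0 <= z means that z is real and nonnegative. *)
Definition possemidef (R : realType) n (A : 'M[R[i]]_n) : Prop :=
  A \is hermsymmx /\ forall v : 'cV[R[i]]_n, 0 <= (v^t* *m A *m v) 0 0.

Definition discrete_analytic (R : realType) p (f : nat -> nat -> 'M[R[i]]_p) :=
  forall m n : nat,
    f m n + 'i%C *: f m.+1 n - 'i%C *: f m n.+1 - f m.+1 n.+1 = 0.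

Definition symmetric_fun (R : realType) p (f : nat -> nat -> 'M[R[i]]_p) :=
  forall m : nat, f m 0%N = (f 0%N m)^t*.

Definition finite_section (R : realType) p (f : nat -> nat -> 'M[R[i]]_p)
    (N : nat) :=
  \mxblock_(m < N.+1, n < N.+1) f m n.

Definition expi (R : realType) (t : R) : R[i] := cos t +i* sin t.

(* A positive matrix-valued measure: a countably additive set function with
   positive semidefinite values. It is finite because its values are matrices.
   Only its values on measurable sets are meaningful. Countable additivity is
   entrywise; R[i]^o is R[i] with the topology of its norm. *)
Record posmxmeasure d (T : measurableType d) (R : realType) (p : nat) :=
  PosMxMeasure {
    mxmeas :> set T -> 'M[R[i]]_p ;
    mxmeas0 : mxmeas set0 = 0 ;
    mxmeas_possemidef : forall A, measurable A -> possemidef (mxmeas A) ;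
    mxmeas_sigma_additive : forall F : (set T)^nat,
      (forall n, measurable (F n)) -> trivIset setT F ->
      forall j k : 'I_p,
        (fun n => \sum_(0 <= l < n) mxmeas (F l) j k : R[i]^o) @ \oo -->
        (mxmeas (\bigcup_n F n) j k : R[i]^o) }.

Section entries.
Context d (T : measurableType d) (R : realType) (p : nat).
Variables (M : posmxmeasure T R p) (j k : 'I_p).

Definition mxmeas_Re (A : set T) : \bar R := (complex.Re (M A j k))%:E.
Definition mxmeas_Im (A : set T) : \bar R := (complex.Im (M A j k))%:E.

Lemma cvg_part (h : R[i] -> R) (u : nat -> R[i]) (l : R[i]) :
  {morph h : x y / x - y} -> (forall z : R[i], (`|h z|)%:C <= `|z|) ->
  (u : nat -> R[i]^o) @ \oo --> (l : R[i]^o) -> h \o u @ \oo --> h l.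
Proof.
move=> hB hle /cvgrPdist_lt ul; apply/cvgrPdist_lt => e e0.
have /ul : 0 < e%:C by rewrite ltcR.
apply: filterS => n un.
by rewrite /= -hB -ltcR; apply: le_lt_trans un; exact: hle.
Qed.

Lemma ReD : {morph @complex.Re R : x y / x + y}.
Proof. by case=> a b [a' b']. Qed.

Lemma ReB : {morph @complex.Re R : x y / x - y}.
Proof. by case=> a b [a' b']. Qed.

Lemma ImD : {morph @complex.Im R : x y / x + y}.
Proof. by case=> a b [a' b']. Qed.

Lemma ImB : {morph @complex.Im R : x y / x - y}.
Proof. by case=> a b [a' b']. Qed.

Lemma Re_le_norm (z : R[i]) : (`|complex.Re z|)%:C <= `|z|.
Proof. exact: normc_ge_Re. Qed.

Lemma Im_le_norm (z : R[i]) : (`|complex.Im z|)%:C <= `|z|.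
Proof.
case: z => a b; rewrite normc_def lecR /= -sqrtr_sqr ler_wsqrtr//.
by rewrite lerDr sqr_ge0.
Qed.

Let mxmeas_Re0 : mxmeas_Re set0 = 0%E.
Proof. by rewrite /mxmeas_Re mxmeas0 mxE. Qed.

Let mxmeas_Re_fin A : measurable A -> mxmeas_Re A \is a fin_num.
Proof. by []. Qed.

Let mxmeas_Re_sigma_additive : semi_sigma_additive mxmeas_Re.
Proof.
move=> F mF tF _; rewrite /mxmeas_Re.
under eq_fun do rewrite sumEFin.
apply: cvg_EFin; first by near=> n.
have := cvg_part ReB Re_le_norm (@mxmeas_sigma_additive _ _ _ _ M _ mF tF j k).
by apply: cvg_trans; apply: near_eq_cvg; near=> n; rewrite /= (big_morph _ ReD erefl).
Unshelve. all: by end_near. Qed.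

HB.instance Definition _ := isCharge.Build d T R mxmeas_Re
  mxmeas_Re0 mxmeas_Re_fin mxmeas_Re_sigma_additive.

Let mxmeas_Im0 : mxmeas_Im set0 = 0%E.
Proof. by rewrite /mxmeas_Im mxmeas0 mxE. Qed.

Let mxmeas_Im_fin A : measurable A -> mxmeas_Im A \is a fin_num.
Proof. by []. Qed.

Let mxmeas_Im_sigma_additive : semi_sigma_additive mxmeas_Im.
Proof.
move=> F mF tF _; rewrite /mxmeas_Im.
under eq_fun do rewrite sumEFin.
apply: cvg_EFin; first by near=> n.
have := cvg_part ImB Im_le_norm (@mxmeas_sigma_additive _ _ _ _ M _ mF tF j k).
by apply: cvg_trans; apply: near_eq_cvg; near=> n; rewrite /= (big_morph _ ImD erefl).
Unshelve. all: by end_near. Qed.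

HB.instance Definition _ := isCharge.Build d T R mxmeas_Im
  mxmeas_Im0 mxmeas_Im_fin mxmeas_Im_sigma_additive.

End entries.

Section integral.
Context d (T : measurableType d) (R : realType).

(* The Jordan decomposition of nu, hence this integral, does not depend on the
   Hahn decomposition that is chosen here. *)
Definition charge_integral (nu : {charge set T -> \bar R}) (D : set T)
    (g : T -> R) : R :=
  let hP := cid (Hahn_decomposition nu) in
  let hN := cid (projT2 hP) in
  Rintegral (jordan_pos (projT2 hN)) D g
  - Rintegral (jordan_neg (projT2 hN)) D g.

Definition complex_integral (nu1 nu2 : {charge set T -> \bar R}) (D : set T)
    (g : T -> R[i]) : R[i] :=
  let u := fun x => complex.Re (g x) in
  let v := fun x => complex.Im (g x) in
  (charge_integral nu1 D u - charge_integral nu2 D v) +i*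
  (charge_integral nu2 D u + charge_integral nu1 D v).

Definition mxmeas_integral p (M : posmxmeasure T R p) (D : set T)
    (g : T -> R[i]) : 'M[R[i]]_p :=
  \matrix_(j, k) complex_integral (mxmeas_Re M j k) (mxmeas_Im M j k) D g.

End integral.

(* Main.v *)
Require Import Defs.
From HB Require Import structures.
From mathcomp Require Import all_boot all_order all_algebra ring lra.
From mathcomp Require Import all_classical all_reals all_analysis.

Import Order.TTheory GRing.Theory Num.Theory.
Import numFieldNormedType.Exports.

Local Open Scope complex_scope.
Local Open Scope ring_scope.
Local Open Scope classical_set_scope.

(** Put b(t) = sqrt 2 e^{it} + i, so that the integrand is conj(b)^m b^n.

    If f is given by such integrals, the quadratic form of a section of f at a
    family (x_n) of vectors is the integral of y^* dM y with
    y(t) = sum_n b(t)^n x_n. It is a limit of Riemann sums of the terms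
    y(t_l)^* M(I_l) y(t_l), which are nonnegative ([moments_possemidef]).

    Conversely, zeta = e^{it} = (b - i) / sqrt 2, and the relation
    (conj b + i)(b - i) = 2 is discrete analyticity. Hence passing from powers
    of b to powers of zeta turns a discrete analytic kernel into a Toeplitz
    kernel ([toeplitz_ofSS]), and the triangular change of basis preserves
    positivity ([psd_toeplitz_of]). What remains is the trigonometric moment
    problem for a nonnegative Toeplitz kernel. For a scalar kernel, the Fejer
    means evaluated at roots of unity are nonnegative weights of finitely many
    nodes whose moments converge to those prescribed ([weighted_sum_cvg]).
    Their distribution functions have a limit along an ultrafilter; its
    right-continuous modification generates a measure, and Riemann sums show
    that this measure has the prescribed moments ([right_cdf_riemann_cvgC]).

    For matrices, the scalar construction is applied to v^* f v for the finitely
    many vectors v of the polarization identity, and the entries of M are the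
    corresponding combinations of scalar measures. Every step of the scalar
    construction is linear in the kernel, since the same ultrafilter serves all
    kernels. So v^* M v is the measure of the kernel v^* f v for every v, first
    on intervals and then on all Borel sets, and M is positive semidefinite
    ([qform_matrix_measure]). *)

Set Implicit Arguments.
Unset Strict Implicit.
Unset Printing Implicit Defensive.

(** * From discrete analytic kernels to Toeplitz kernels *)

Section circle_shift.
Variable R : realType.
Implicit Types (u v : nat -> R[i]) (c : nat -> nat -> R[i]).

Let s2 : R[i] := (Num.sqrt 2)%:C.

Lemma conjC_real (x : R) : (x%:C)^* = x%:C.
Proof. exact: conjc_real. Qed.

Lemma conjC_i : 'i%C^* = - 'i%C :> R[i].
Proof. by apply/eqP; rewrite eq_complex /= oppr0 !eqxx. Qed.

Lemma sqr_sqrt2C : s2 ^+ 2 = 2 :> R[i].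
Proof. by rewrite -rmorphXn /= sqr_sqrtr ?ler0n// rmorph_nat. Qed.

Lemma sqrt2C_neq0 : s2 != 0 :> R[i].
Proof.
by apply/eqP => s0; have /eqP := sqr_sqrt2C; rewrite s0 expr0n eq_sym pnatr_eq0.
Qed.

(** If u n = b^n with b = sqrt 2 zeta + i, this is multiplication by
    zeta = (b - i) / sqrt 2. The coshift is multiplication by conj zeta on the
    powers of conj b. *)
Definition circle_shift u n : R[i] := (u n.+1 - 'i%C * u n) / s2.

Definition circle_coshift u n : R[i] := (u n.+1 + 'i%C * u n) / s2.

Lemma iter_circle_shiftD n (x y : R[i]) u v :
  iter n circle_shift (fun k => x * u k + y * v k) =
  fun k => x * iter n circle_shift u k + y * iter n circle_shift v k.
Proof.
elim: n => // n /= ->; apply/funext => k; rewrite /circle_shift; ring.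
Qed.

Lemma iter_circle_coshift n u k :
  iter n circle_coshift u k = (iter n circle_shift (fun j => (u j)^*) k)^*.
Proof.
elim: n k => [|n IHn] k /=; first by rewrite conjCK.
rewrite /circle_coshift /circle_shift !IHn rmorphM rmorphB rmorphM fmorphV /=.
by rewrite conjC_real conjC_i mulNr opprK.
Qed.

(** The coefficients b do not depend on u: a combination of powers of zeta
    is a polynomial in b, and this change of basis will be applied to all rows
    and, conjugated, to all columns of a kernel. *)
Lemma iter_circle_shift_comb N (a : nat -> R[i]) : exists K (b : nat -> R[i]),
  forall u, \sum_(n < N) a n * iter n circle_shift u 0 = \sum_(k < K) b k * u k.
Proof.
elim: N a => [|N IHN] a.
  by exists 0%N, (fun=> 0) => u; rewrite !big_ord0.
have [K [b bE]] := IHN (a \o S).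
exists K.+1, (fun k => (k == 0%N)%:R * a 0 + (0 < k)%:R * (b k.-1 / s2)
  + (k < K)%:R * (- ('i%C / s2) * b k)) => u.
rewrite big_ord_recl.
under eq_bigr do rewrite lift0 iterSr.
rewrite (bE (circle_shift u)).
under [RHS]eq_bigr do rewrite mulrDl.
rewrite big_split /= [X in _ = X + _]big_ord_recl [X in _ =
  _ + X]big_ord_recr /=.
rewrite !ltnn /= !mul0r !addr0 mul1r -addrA; congr (_ + _).
rewrite -big_split /=; apply: eq_bigr => k _.
rewrite /bump /= add0n add1n ltn_ord /= !mul1r add0r /circle_shift; ring.
Qed.

(** If c m n is the integral of conj(b)^m b^n, this is the integral of
    conj(zeta)^m zeta^n. *)
Definition toeplitz_of c m n : R[i] :=
  iter m circle_coshift (fun j => iter n circle_shift (c j) 0) 0.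

Definition analytic_kernel c := forall m n,
  c m n + 'i%C * c m.+1 n - 'i%C * c m n.+1 - c m.+1 n.+1 = 0.

(** The identity conj(zeta) zeta = 1: on an analytic kernel, the shift in
    the second index followed by the coshift in the first is the identity. *)
Lemma toeplitz_ofSS c m n : analytic_kernel c ->
  toeplitz_of c m.+1 n.+1 = toeplitz_of c m n.
Proof.
move=> ca; rewrite /toeplitz_of iterSr; congr (iter _ _ _ 0).
apply/funext => j; rewrite /circle_coshift !iterSr.
have key : (fun k => s2^-1 * circle_shift (c j.+1) k + ('i%C / s2)
  * circle_shift (c j) k) = c j.
  apply/funext => k; rewrite /circle_shift.
  have <- : c j k + 'i%C * c j.+1 k - 'i%C * c j k.+1 = c j.+1 k.+1.
    by apply/eqP; rewrite -subr_eq0 ca.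
  have -> : s2^-1 = s2 / 2.
    by rewrite -sqr_sqrt2C expr2 invfM mulrA divff ?mul1r ?sqrt2C_neq0.
  transitivity ((1 - 'i%C ^+ 2) * (s2 ^+ 2 / 4) * c j k); first by field.
  by rewrite sqr_i sqr_sqrt2C; field.
by rewrite -[in RHS]key iter_circle_shiftD; ring.
Qed.

Definition psd_kernel c := forall K (b : nat -> R[i]),
  0 <= \sum_(m < K) \sum_(n < K) (b m)^* * b n * c m n.

(** A Hermitian form stays nonnegative after a change of basis, here from
    the powers of b to those of zeta. *)
Lemma psd_toeplitz_of c : psd_kernel c -> psd_kernel (toeplitz_of c).
Proof.
move=> cp N a; have [K [b bE]] := iter_circle_shift_comb N a.
suff -> : \sum_(m < N) \sum_(n < N) (a m)^* * a n * toeplitz_of c m n =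
  \sum_(m < K) \sum_(n < K) (b m)^* * b n * c m n by exact: cp.
have coE u : \sum_(m < N) (a m)^* * iter m circle_coshift u 0 =
  \sum_(k < K) (b k)^* * u k.
  under eq_bigr do rewrite iter_circle_coshift -rmorphM.
  rewrite -rmorph_sum bE rmorph_sum.
  by apply: eq_bigr => k _; rewrite rmorphM /= conjCK.
rewrite exchange_big /=.
transitivity (\sum_(n < N) a n * \sum_(m < K) (b m)^*
  * iter n circle_shift (c m) 0).
  apply: eq_bigr => n _;
    rewrite -(coE (fun m => iter n circle_shift (c m) 0)) mulr_sumr.
  by apply: eq_bigr => m _; rewrite /toeplitz_of; ring.
under [LHS]eq_bigr do rewrite mulr_sumr.
rewrite exchange_big /=; apply: eq_bigr => m _.
transitivity ((b m)^* * \sum_(n < N) a n * iter n circle_shift (c m) 0).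
  by rewrite mulr_sumr; apply: eq_bigr => n _; ring.
by rewrite bE mulr_sumr; apply: eq_bigr => k _; ring.
Qed.

End circle_shift.

(** * Sums over roots of unity *)

Section roots_of_unity.
Variable R : realType.
Implicit Types (x y : R).

Lemma expiD x y : expi (x + y) = expi x * expi y.
Proof. by apply/eqP; rewrite eq_complex /= cosD sinD eqxx addrC eqxx. Qed.

Lemma expi0 : expi (0 : R) = 1.
Proof. by rewrite /expi cos0 sin0. Qed.

Lemma expiMn x n : expi (n%:R * x) = expi x ^+ n.
Proof.
elim: n => [|n IHn]; first by rewrite mul0r expi0.
by rewrite exprS -IHn -expiD -nat1r mulrDl mul1r.
Qed.

Lemma expiN x : expi (- x) = (expi x)^*.
Proof. by rewrite /expi cosN sinN. Qed.

Lemma expiJ x : expi x * (expi x)^* = 1.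
Proof. by rewrite -expiN -expiD subrr expi0. Qed.

Lemma expi2pi : expi (2 * pi : R) = 1.
Proof. by rewrite mulr_natl /expi cos2pi sin2pi. Qed.

(** cos x = 1 - 2 sin(x/2)^2, and sin is positive on ]0, pi[. *)
Lemma expi_neq1 x : 0 < x < 2 * pi -> expi x != 1.
Proof.
move=> x02; apply/eqP => -[cx _].
have x2 : x = (x / 2) *+ 2 by rewrite -mulr_natr divfK ?pnatr_eq0.
have s0 : 0 < sin (x / 2) by apply: sin_gt0_pi; lra.
move: cx; rewrite x2 cos_mulr2n cos2sin2 => /eqP.
rewrite mulrnBl -addrA -subr_eq0 => /eqP h.
have : sin (x / 2) ^+ 2 = 0 by lra.
by move/eqP; rewrite sqrf_eq0 gt_eqF.
Qed.

(** The arguments in [0, 2 pi[ of the roots of unity of order 2K. *)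
Definition node K l : R := pi * l%:R / K%:R.

Lemma node_lt2pi K l : (l < 2 * K)%N -> node K l < 2 * pi.
Proof.
move=> lK; have K0 : (0 < K)%N by case: K lK.
rewrite /node ltr_pdivrMr ?ltr0n// [ltRHS]mulrAC [ltLHS]mulrC.
by rewrite ltr_pM2r ?pi_gt0// -natrM ltr_nat.
Qed.

Lemma node_ge0 K l : 0 <= node K l.
Proof. by rewrite /node divr_ge0 ?mulr_ge0 ?pi_ge0. Qed.

Lemma expi_node K l : expi (node K l) = expi (node K 1) ^+ l.
Proof. by rewrite -expiMn; congr expi; rewrite /node; ring. Qed.

(** If p <> q, the summands are the powers of a root of unity of order 2K
    which differs from 1 because |p - q| < 2K; their geometric sum vanishes. *)
Lemma sum_expi_node K p q : (p < 2 * K)%N -> (q < 2 * K)%N ->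
  \sum_(l < 2 * K) expi (node K l) ^+ p * (expi (node K l))^* ^+ q =
  if p == q then (2 * K)%:R else 0.
Proof.
move=> pK qK; have K0 : (0 < K)%N by case: K pK {qK}.
set z := expi (node K 1).
have zz : z * z^* = 1 by exact: expiJ.
have zE d : (0 < d)%N -> (d < 2 * K)%N -> z ^+ d != 1.
  move=> d0 dK; rewrite -expi_node expi_neq1// node_lt2pi// andbT.
  by rewrite /node divr_gt0 ?mulr_gt0 ?pi_gt0 ?ltr0n.
have z2K : z ^+ (2 * K) = 1.
  rewrite -expi_node -[RHS]expi2pi; congr expi; rewrite /node natrM.
  by field; rewrite pnatr_eq0 -lt0n.
set r := z ^+ p * z^* ^+ q.
transitivity (\sum_(l < 2 * K) r ^+ l).
  apply: eq_bigr => l _; rewrite expi_node -/z rmorphXn /= /r exprMn -!exprM.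
  by rewrite mulnC [(l * q)%N]mulnC.
have [pq|pq] := eqVneq p q.
  under eq_bigr do rewrite /r pq -exprMn zz !expr1n.
  by rewrite sumr_const card_ord.
have r1 : r != 1.
  apply/eqP => rE.
  have zpq : z ^+ p = z ^+ q.
    by rewrite -[RHS]mul1r -rE /r -mulrA -exprMn [z^* * z]mulrC zz expr1n mulr1.
  have zn0 : z != 0 by apply/eqP => z0; move: zz; rewrite z0 mul0r => /eqP;
    rewrite eq_sym oner_eq0.
  have aux a b : (a < b)%N -> (b < 2 * K)%N -> z ^+ a = z ^+ b -> False.
    move=> ab bK zab; have := zE (b - a)%N; rewrite subn_gt0 ab => /(_ isT).
    rewrite (leq_ltn_trans (leq_subr _ _) bK) => /(_ isT) /eqP; apply.
    apply: (mulfI (expf_neq0 a zn0)).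
    by rewrite -exprD subnKC ?(ltnW ab)// mulr1.
  move: pq; rewrite neq_ltn => /orP[h|h]; first exact: (aux _ _ h).
  exact: (aux _ _ h).
have : (r - 1) * \sum_(l < 2 * K) r ^+ l = 0.
  rewrite -subrX1 /r exprMn -!exprM mulnC exprM z2K expr1n mul1r.
  by rewrite mulnC exprM -rmorphXn z2K rmorph1 expr1n subrr.
by move/eqP; rewrite mulf_eq0 subr_eq0 (negbTE r1) => /eqP.
Qed.

End roots_of_unity.

(** * Convergence in R[i] *)

Lemma cvg_near_eq (T : Type) (U : topologicalType)
    (F : set_system T) {FF : Filter F}
    (f g : T -> U) (l : U) :
  (\forall x \near F, f x = g x) -> f x @[x --> F] --> l ->
  g x @[x --> F] --> l.
Proof. by move=> fg fl; exact: cvg_trans (near_eq_cvg fg) fl. Qed.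

Section complex_cvg.
Variable R : realType.

Lemma normC_real (x : R) : `|x%:C| = `|x|%:C.
Proof. by rewrite normc_def /= expr0n addr0 sqrtr_sqr. Qed.

Lemma cvg_toC (T : Type) (F : set_system T) {FF : Filter F} (u : T -> R)
    (l : R) :
  u x @[x --> F] --> l -> ((u x)%:C : R[i]^o) @[x --> F] --> (l%:C : R[i]^o).
Proof.
move=> /cvgrPdist_lt ul; apply/cvgrPdist_lt => e.
case: e => e e'; rewrite ltcE /= => /andP[/eqP -> e0].
have := ul _ e0; apply: filterS => x xe.
by rewrite -rmorphB /= normC_real ltcR.
Qed.

Lemma cvg_scaleC (T : Type) (F : set_system T) {FF : Filter F} (u : T -> R[i])
    (z l : R[i]) :
  (u x : R[i]^o) @[x --> F] --> (l : R[i]^o) ->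
  (z * u x : R[i]^o) @[x --> F] --> (z * l : R[i]^o).
Proof. exact: cvgZl_tmp. Qed.

Lemma cvg_ReIm (T : Type) (F : set_system T) {FF : Filter F} (u : T -> R[i])
    (l : R[i]) :
  complex.Re (u x) @[x --> F] --> complex.Re l ->
  complex.Im (u x) @[x --> F] --> complex.Im l ->
  (u x : R[i]^o) @[x --> F] --> (l : R[i]^o).
Proof.
move=> /cvg_toC cR /cvg_toC cI.
have e : (l : R[i]^o) =
  (complex.Re l)%:C + 'i%C *: ((complex.Im l)%:C : R[i]^o).
  exact: complexE.
have eu : u = fun x => (complex.Re (u x))%:C + 'i%C * (complex.Im (u x))%:C.
  by apply/funext => x; exact: complexE.
by rewrite e eu; exact: cvgD cR (cvgZl_tmp (k := 'i%C) cI).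
Qed.

Lemma cvg_Re (u : nat -> R[i]) (l : R[i]) :
  (u : nat -> R[i]^o) @ \oo --> (l : R[i]^o) ->
  complex.Re (u n) @[n --> \oo] --> complex.Re l.
Proof. exact: cvg_part (@ReB R) (@Re_le_norm R). Qed.

Lemma cvg_Im (u : nat -> R[i]) (l : R[i]) :
  (u : nat -> R[i]^o) @ \oo --> (l : R[i]^o) ->
  complex.Im (u n) @[n --> \oo] --> complex.Im l.
Proof. exact: cvg_part (@ImB R) (@Im_le_norm R). Qed.

Lemma complexRe_conj (z : R[i]) : complex.Re (z^*)%R = complex.Re z.
Proof. by case: z. Qed.

Lemma complexIm_conj (z : R[i]) : complex.Im (z^*)%R = - complex.Im z.
Proof. by case: z. Qed.

Lemma cvg_conj (u : nat -> R[i]) (l : R[i]) :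
  (u : nat -> R[i]^o) @ \oo --> (l : R[i]^o) ->
  ((u n)^* : R[i]^o) @[n --> \oo] --> (l^* : R[i]^o).
Proof.
move=> ul; apply: cvg_ReIm.
  by rewrite complexRe_conj; under eq_fun do rewrite complexRe_conj;
    exact: cvg_Re.
by rewrite complexIm_conj; under eq_fun do rewrite complexIm_conj; apply: cvgN;
  exact: cvg_Im.
Qed.

End complex_cvg.

(** * Fejer weights *)

Section weights.
Variable R : realType.
Implicit Types (c : nat -> nat -> R[i]) (t : R).

Let s2 : R[i] := (Num.sqrt 2)%:C.

Lemma iter_circle_shift_sum (I : finType) n (x : I -> R[i])
    (u : I -> nat -> R[i]) :
  iter n (@circle_shift R) (fun k => \sum_i x i * u i k) =
  fun k => \sum_i x i * iter n (@circle_shift R) (u i) k.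
Proof.
elim: n => // n /= ->; apply/funext => k;
  rewrite /circle_shift mulr_sumr -sumrB mulr_suml.
by apply: eq_bigr => i _; ring.
Qed.

Lemma iter_circle_coshift_sum (I : finType) n (x : I -> R[i])
    (u : I -> nat -> R[i]) :
  iter n (@circle_coshift R) (fun k => \sum_i x i * u i k) =
  fun k => \sum_i x i * iter n (@circle_coshift R) (u i) k.
Proof.
elim: n => // n /= ->; apply/funext => k.
rewrite /circle_coshift mulr_sumr -big_split /= mulr_suml.
by apply: eq_bigr => i _; ring.
Qed.

Lemma toeplitz_of_sum (I : finType) (x : I -> R[i])
    (c : I -> nat -> nat -> R[i]) m n :
  toeplitz_of (fun j k => \sum_i x i * c i j k) m n =
  \sum_i x i * toeplitz_of (c i) m n.
Proof.
rewrite /toeplitz_of.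
have -> : (fun j => iter n (@circle_shift R) (fun k => \sum_i x i
  * c i j k) 0%N) =
   fun j => \sum_i x i * iter n (@circle_shift R) (c i j) 0%N.
  by apply/funext => j; rewrite iter_circle_shift_sum.
by rewrite iter_circle_coshift_sum.
Qed.

(** The Fejer mean of order N+1 of the Fourier series with coefficients
    toeplitz_of c 0 k, at the l-th node, divided by the number 2(N+1) of nodes.
    Written as a double sum it is a value of the form of the Toeplitz kernel. *)
Definition weight c N l : R[i] :=
  (2 * N.+1%:R ^+ 2)^-1 * \sum_(m < N.+1) \sum_(n < N.+1)
    expi (node R N.+1 l) ^+ m * (expi (node R N.+1 l))^* ^+ n
      * toeplitz_of c m n.

Lemma weight_sum (I : finType) (x : I -> R[i])
    (c : I -> nat -> nat -> R[i]) N l :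
  weight (fun j k => \sum_i x i * c i j k) N l = \sum_i x i * weight (c i) N l.
Proof.
rewrite /weight; under [RHS]eq_bigr do rewrite mulrCA.
rewrite -mulr_sumr; congr (_ * _).
under [RHS]eq_bigr do rewrite mulr_sumr.
rewrite [RHS]exchange_big /=; apply: eq_bigr => m _.
under [RHS]eq_bigr do rewrite mulr_sumr.
rewrite [RHS]exchange_big /=; apply: eq_bigr => n _.
by rewrite toeplitz_of_sum mulr_sumr; apply: eq_bigr => i _; ring.
Qed.

Lemma weight_ge0 c N l : psd_kernel c -> 0 <= weight c N l.
Proof.
move=> /psd_toeplitz_of cp; apply: mulr_ge0.
  by rewrite invr_ge0 mulr_ge0 ?exprn_ge0 ?ler0n.
have := cp N.+1 (fun n => (expi (node R N.+1 l))^* ^+ n).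
have conjXK (z : R[i]) n : (z^* ^+ n)^* = z ^+ n.
  by rewrite rmorphXn /= conjCK.
by under eq_bigr do under eq_bigr do rewrite conjXK.
Qed.

Lemma toeplitz_ofD c m k : analytic_kernel c ->
  toeplitz_of c m (k + m) = toeplitz_of c 0 k.
Proof.
move=> ca; elim: m => [|m IHm]; first by rewrite addn0.
by rewrite addnS toeplitz_ofSS.
Qed.

(** Having twice as many nodes as terms prevents aliasing: the exponents
    k + m and n are less than 2(N+1), so only the N+1-k pairs with n = k + m
    survive, and they all contribute toeplitz_of c 0 k. *)
Lemma weight_moment c N k : analytic_kernel c -> (k <= N.+1)%N ->
  \sum_(l < 2 * N.+1) expi (node R N.+1 l) ^+ k * weight c N l =
  (N.+1 - k)%N%:R / N.+1%:R * toeplitz_of c 0 k.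
Proof.
move=> ca kN; set K := N.+1 in kN *.
under eq_bigr do rewrite /weight mulrCA.
rewrite -mulr_sumr -/K.
have -> : \sum_(l < 2 * K) expi (node R K l) ^+ k *
   (\sum_(m < K) \sum_(n < K)
      expi (node R K l) ^+ m * (expi (node R K l))^* ^+ n * toeplitz_of c m n) =
   \sum_(m < K) \sum_(n < K) toeplitz_of c m n
     * (if (k + m == n)%N then (2 * K)%:R else 0).
  under eq_bigr do rewrite mulr_sumr.
  rewrite exchange_big /=; apply: eq_bigr => m _.
  under eq_bigr do rewrite mulr_sumr.
  rewrite exchange_big /=; apply: eq_bigr => n _.
  rewrite -sum_expi_node; first last.
  - by rewrite (leq_trans (ltn_ord n))// leq_pmull.
  - by rewrite mul2n -addnn -addnS leq_add.
  rewrite mulr_sumr; apply: eq_bigr => l _; rewrite exprD; ring.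
have -> : \sum_(m < K) \sum_(n < K) toeplitz_of c m n *
     (if (k + m == n)%N then (2 * K)%:R else 0) =
   \sum_(m < K | (m < K - k)%N) (2 * K)%:R * toeplitz_of c 0 k.
  rewrite [RHS]big_mkcond /=; apply: eq_bigr => m _.
  rewrite ltn_subRL; case: ifPn => mK; last first.
    rewrite big1// => n _; case: eqP => [kmn|]; last by rewrite mulr0.
    by move: mK; rewrite kmn ltn_ord.
  rewrite (bigD1 (Ordinal mK)) //= eqxx big1 ?addr0; last first.
    move=> n nm; case: eqP => [kmn|]; last by rewrite mulr0.
    by move/eqP: nm; case; apply/val_inj.
  by rewrite toeplitz_ofD// mulrC.
have <- := big_ord_widen K (fun=> (2 * K)%:R
  * toeplitz_of c 0 k) (leq_subr k K).
rewrite sumr_const card_ord -mulr_natl natrM.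
have K0 : (K%:R : R[i]) != 0 by rewrite pnatr_eq0.
by field.
Qed.

Lemma cvg_ratio k : ((N.+1 - k)%N%:R / N.+1%:R : R) @[N --> \oo] --> (1 : R).
Proof.
have : (1 - k%:R * harmonic N : R) @[N --> \oo] --> (1 - k%:R * 0 : R).
  by apply: cvgB; [exact: cvg_cst|apply: cvgMl_tmp; exact: cvg_harmonic].
rewrite mulr0 subr0; apply: cvg_near_eq; near=> N.
rewrite /harmonic /= natrB; last by apply: ltnW; near: N; exists k => // n /=.
have : (N.+1%:R : R) != 0 by rewrite pnatr_eq0.
by move=> h; field.
Unshelve. all: by end_near. Qed.

Definition cosymbol t : R[i] := s2 * expi (- t) - 'i%C.
Definition symbol t : R[i] := s2 * expi t + 'i%C.

Definition weighted_sum c (g : R -> R[i]) N : R[i]^o :=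
  \sum_(l < 2 * N.+1) g (node R N.+1 l) * weight c N l.

Lemma weighted_sum0 c k : analytic_kernel c ->
  weighted_sum c (fun t => expi t ^+ k) @ \oo --> (toeplitz_of c 0 k : R[i]^o).
Proof.
move=> ca.
have : (toeplitz_of c 0 k * ((N.+1 - k)%N%:R / N.+1%:R : R)%:C :
  R[i]^o) @[N --> \oo] -->
    (toeplitz_of c 0 k * 1%:C : R[i]^o) by apply: cvg_scaleC; apply: cvg_toC;
      exact: cvg_ratio.
rewrite mulr1; apply: cvg_near_eq; near=> N.
rewrite /weighted_sum weight_moment//; last first.
  by apply: ltnW; near: N; exists k => // n /=.
by rewrite mulrC rmorphM /= fmorphV !rmorph_nat.
Unshelve. all: by end_near. Qed.

End weights.

(** * Convergence of the weighted sums *)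

Section weighted_sums.
Variable R : realType.
Implicit Types (c : nat -> nat -> R[i]) (t : R).

Let s2 : R[i] := (Num.sqrt 2)%:C.

Lemma weighted_sumD c (x y : R[i]) (g h : R -> R[i]) N :
  weighted_sum c (fun t => x * g t + y * h t) N =
  x * weighted_sum c g N + y * weighted_sum c h N.
Proof.
rewrite /weighted_sum !mulr_sumr -big_split /=.
by apply: eq_bigr => l _; rewrite mulrDl !mulrA.
Qed.

Lemma cvg_weighted_sum_lin c (x y : R[i]) (g h k : R -> R[i]) (a b : R[i]) :
  (forall t, k t = x * g t + y * h t) ->
  weighted_sum c g @ \oo --> (a : R[i]^o) ->
  weighted_sum c h @ \oo --> (b : R[i]^o) ->
  weighted_sum c k @ \oo --> (x * a + y * b : R[i]^o).
Proof.
move=> /funext -> ga hb.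
rewrite (_ : weighted_sum c _ =
    (fun N => x * weighted_sum c g N + y * weighted_sum c h N : R[i]^o)).
  exact: (cvgD (cvg_scaleC (z := x) ga) (cvg_scaleC (z := y) hb)).
by apply/funext => N; rewrite weighted_sumD.
Qed.

(** The relation b^{n+1} = sqrt 2 zeta b^n + i b^n undoes the shift: an
    induction on n leads back to the powers of zeta. *)
Lemma weighted_sum_row c k n : analytic_kernel c ->
  weighted_sum c (fun t => expi t ^+ k * symbol t ^+ n) @ \oo -->
  (iter k (@circle_shift R) (c 0) n : R[i]^o).
Proof.
move=> ca; elim: n k => [|n IHn] k.
  under [X in weighted_sum _ X]eq_fun do rewrite expr0 mulr1.
  exact: weighted_sum0.
have -> : iter k (@circle_shift R) (c 0) n.+1 =
    s2 * iter k.+1 (@circle_shift R) (c 0) n + 'i%C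
      * iter k (@circle_shift R) (c 0) n.
  by rewrite iterS /circle_shift mulrC divfK ?sqrt2C_neq0// subrK.
apply: (cvg_weighted_sum_lin _ (IHn k.+1) (IHn k)) => t.
by rewrite exprS /symbol -/s2 [in RHS]exprS; ring.
Qed.

Definition positive_analytic c :=
  [/\ psd_kernel c, analytic_kernel c & forall m, c m 0 = (c 0 m)^*].

Lemma conj_cosymbol t : (cosymbol t)^* = symbol t :> R[i].
Proof.
rewrite /cosymbol /symbol rmorphB rmorphM /= conjC_real conjC_i opprK.
by rewrite expiN conjCK.
Qed.

(** The relation (conj b + i)(b - i) = 2. *)
Lemma cosymbolM t : cosymbol t * symbol t =
  1 + 'i%C * cosymbol t - 'i%C * symbol t :> R[i].
Proof.
have e1 : expi t * expi (- t) = 1 :> R[i] by rewrite -expiD subrr expi0.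
have i2 := sqr_i R.
have s22 := sqr_sqrt2C R.
rewrite /cosymbol /symbol -/s2.
transitivity (s2 ^+ 2 * (expi t * expi (- t)) - 'i%C ^+ 2 + 'i%C * s2
  * expi (-t)
  - 'i%C * s2 * expi t); first by ring.
transitivity (1 - 2 * 'i%C ^+ 2 + 'i%C * s2 * expi (-t)
  - 'i%C * s2 * expi t : R[i]); last by ring.
by rewrite e1 i2 s22; ring.
Qed.

(** The first row has been treated, the first column is its conjugate
    because the weights are real, and both sides obey the same recurrence,
    which determines a discrete analytic function from these two. *)
Lemma weighted_sum_cvg c m n : positive_analytic c ->
  weighted_sum c (fun t => cosymbol t ^+ m * symbol t ^+ n) @ \oo -->
    (c m n : R[i]^o).
Proof.
move=> [cp ca ch]; elim: m n => [|m IHm] n.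
  under [X in weighted_sum _ X]eq_fun do rewrite expr0.
  by have := @weighted_sum_row c 0 n ca.
elim: n => [|n IHn].
  rewrite ch (_ : weighted_sum _ _ =
    (fun N => (weighted_sum c (fun t => expi t ^+ 0 * symbol t ^+ m.+1) N)^*
      : R[i]^o)); last first.
    apply/funext => N; rewrite /weighted_sum rmorph_sum /=.
    apply: eq_bigr => l _; rewrite rmorphM /= (geC0_conj (weight_ge0 _ _ cp)).
    by rewrite -conj_cosymbol expr0 mul1r mulr1 rmorphXn /= conjCK.
  by apply: cvg_conj; exact: (@weighted_sum_row c 0 m.+1 ca).
have -> : c m.+1 n.+1 = 1 * c m n + 1 * ('i%C * c m.+1 n + (- 'i%C) * c m n.+1).
  by apply/esym/eqP; rewrite !mul1r mulNr -subr_eq0 addrA ca.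
apply: (cvg_weighted_sum_lin _ (IHm n)).
  2: by apply: (cvg_weighted_sum_lin _ IHn (IHm n.+1)) => t.
move=> t /=; rewrite !exprS.
transitivity (cosymbol t * symbol t * (cosymbol t ^+ m * symbol t ^+ n));
  first by ring.
by rewrite cosymbolM; ring.
Qed.

Lemma weighted_sum1 c N : positive_analytic c ->
  weighted_sum c (fun=> 1) N = c 0 0.
Proof.
move=> [cp ca ch]; rewrite /weighted_sum -[RHS]/(toeplitz_of c 0 0).
have := weight_moment ca (leq0n N.+1);
  rewrite subn0 divff ?pnatr_eq0// mul1r => <-.
by apply: eq_bigr => l _; rewrite expr0.
Qed.

End weighted_sums.

(** * Bounded Lipschitz functions *)

Section bounded_lipschitz.
Variable R : realType.

(** One constant for both bounds is enough; such functions are stable under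
    products, and their Riemann sums have explicit errors. *)
Definition bounded_lipschitz (g : R -> R) := exists2 B : R,
    (forall x, `|g x| <= B) &
  forall x y, `|g x - g y| <= B * `|x - y|.

Lemma bounded_lipschitz_cst a : bounded_lipschitz (fun=> a).
Proof. by exists `|a| => // x y; rewrite subrr normr0 mulr_ge0. Qed.

Lemma bounded_lipschitzD g h : bounded_lipschitz g -> bounded_lipschitz h ->
    bounded_lipschitz (fun x => g x + h x).
Proof.
move=> [B gB gL] [C hC hL]; exists (B + C) => [x|x y] /=.
  by rewrite (le_trans (ler_normD _ _))// lerD.
by rewrite opprD addrACA (le_trans (ler_normD _ _))// mulrDl lerD.
Qed.

Lemma bounded_lipschitzN g : bounded_lipschitz g ->
    bounded_lipschitz (fun x => - g x).
Proof.
move=> [B gB gL]; exists B => [x|x y] /=; first by rewrite normrN.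
by rewrite -opprD normrN.
Qed.

Lemma bounded_lipschitzM g h : bounded_lipschitz g -> bounded_lipschitz h ->
    bounded_lipschitz (fun x => g x * h x).
Proof.
move=> [B gB gL] [C hC hL].
have B0 : 0 <= B by apply: le_trans (gB 0).
have C0 : 0 <= C by apply: le_trans (hC 0).
exists (B * C + B * C) => [x|x y] /=.
  rewrite normrM (@le_trans _ _ (B * C))//; first by rewrite ler_pM.
  by rewrite lerDl mulr_ge0.
have -> : g x * h x - g y * h y = g x * (h x - h y) + (g x - g y) * h y by ring.
rewrite (le_trans (ler_normD _ _))// [leRHS]mulrDl lerD// normrM.
  by rewrite -mulrA ler_pM.
by rewrite mulrAC ler_pM.
Qed.

Lemma lipschitz1_MVT (f df : R -> R) :
  (forall x : R, is_derive x (1 : R) f (df x)) -> (forall x, `|df x| <= 1) ->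
  forall x y, `|f x - f y| <= 1 * `|x - y|.
Proof.
move=> fd f1.
have aux x y : x < y -> `|f x - f y| <= 1 * `|x - y|.
  move=> xy; have [|z _ fz] := @MVT R f df x y xy (fun z _ => fd z).
    apply: continuous_subspaceT => z.
    by apply/differentiable_continuous/derivable1_diffP; case: (fd z).
  by rewrite distrC fz normrM [`|x - y|]distrC ler_wpM2r.
move=> x y; have [xy|xy|->] := ltgtP x y; last by rewrite !subrr normr0 mulr0.
- exact: aux.
- by rewrite distrC [`|x - y|]distrC; exact: aux.
Qed.

Lemma bounded_lipschitz_cos : bounded_lipschitz (@cos R).
Proof.
exists 1; first exact: cos_max.
by apply: (@lipschitz1_MVT _ (fun x => - sin x)) => x; rewrite normrN sin_max.
Qed.

Lemma bounded_lipschitz_sin : bounded_lipschitz (@sin R).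
Proof.
by exists 1; [exact: sin_max|apply: (@lipschitz1_MVT _ cos) => x;
  exact: cos_max].
Qed.

Lemma bounded_lipschitz_continuous g : bounded_lipschitz g -> continuous g.
Proof.
move=> [B gB gL] x; apply/cvgrPdist_lt => e e0.
have B0 : 0 <= B by apply: le_trans (gB 0).
near=> y; rewrite (le_lt_trans (gL _ _))//
  (@le_lt_trans _ _ ((B + 1) * `|x - y|))//.
  by rewrite ler_wpM2r// lerDl.
rewrite mulrC -ltr_pdivlMr ?ltr_wpDl//.
near: y; apply: cvgr_dist_lt => //.
by rewrite divr_gt0// ltr_wpDl.
Unshelve. all: by end_near. Qed.

Definition bounded_lipschitzC (g : R -> R[i]) :=
  bounded_lipschitz (fun x => complex.Re (g x))
    /\ bounded_lipschitz (fun x => complex.Im (g x)).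

Lemma bounded_lipschitzC_cst a : bounded_lipschitzC (fun=> a).
Proof. by split; exact: bounded_lipschitz_cst. Qed.

Lemma bounded_lipschitzCD g h : bounded_lipschitzC g -> bounded_lipschitzC h ->
    bounded_lipschitzC (fun x => g x + h x).
Proof.
move=> [gr gi] [hr hi]; split.
  by under eq_fun do rewrite ReD; exact: bounded_lipschitzD.
by under eq_fun do rewrite ImD; exact: bounded_lipschitzD.
Qed.

Lemma complexReM (z w : R[i]) : complex.Re (z * w) =
  complex.Re z * complex.Re w - complex.Im z * complex.Im w.
Proof. by case: z w => a b []. Qed.

Lemma complexImM (z w : R[i]) : complex.Im (z * w) =
  complex.Re z * complex.Im w + complex.Im z * complex.Re w.
Proof. by case: z w => a b []. Qed.

Lemma bounded_lipschitzCM g h : bounded_lipschitzC g -> bounded_lipschitzC h ->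
    bounded_lipschitzC (fun x => g x * h x).
Proof.
move=> [gr gi] [hr hi]; split.
  under eq_fun do rewrite complexReM.
  by apply: bounded_lipschitzD; [|apply: bounded_lipschitzN];
    exact: bounded_lipschitzM.
under eq_fun do rewrite complexImM.
by apply: bounded_lipschitzD; exact: bounded_lipschitzM.
Qed.

Lemma bounded_lipschitzCX g n : bounded_lipschitzC g ->
    bounded_lipschitzC (fun x => g x ^+ n).
Proof.
move=> gb; elim: n => [|n IHn].
  by under eq_fun do rewrite expr0; exact: bounded_lipschitzC_cst.
by under eq_fun do rewrite exprS; exact: bounded_lipschitzCM.
Qed.

Lemma bounded_lipschitzC_conj g : bounded_lipschitzC g ->
    bounded_lipschitzC (fun x => ((g x)^*)%R).
Proof.
move=> [gr gi]; split; first by under eq_fun do rewrite complexRe_conj.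
by under eq_fun do rewrite complexIm_conj; exact: bounded_lipschitzN.
Qed.

Lemma bounded_lipschitzC_expi : bounded_lipschitzC (@expi R).
Proof.
by split; [exact: bounded_lipschitz_cos|exact: bounded_lipschitz_sin].
Qed.

Lemma bounded_lipschitzC_symbol : bounded_lipschitzC (@symbol R).
Proof.
apply: bounded_lipschitzCD; last exact: bounded_lipschitzC_cst.
by apply: bounded_lipschitzCM;
  [exact: bounded_lipschitzC_cst|exact: bounded_lipschitzC_expi].
Qed.

Lemma bounded_lipschitzC_cosymbol : bounded_lipschitzC (@cosymbol R).
Proof.
have := bounded_lipschitzC_conj bounded_lipschitzC_symbol.
by under eq_fun do rewrite -conj_cosymbol conjCK.
Qed.

End bounded_lipschitz.

(** * Limits along an ultrafilter *)

Section ultralimits.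

(** All bounded real sequences converge along this ultrafilter, and sums of
    limits are limits of sums. One choice for all sequences keeps the linear
    relations between them, which separate subsequences would lose. *)
Definition ultra_infty : set_system nat :=
  sval (cid (ultraFilterLemma eventually_filter)).

Lemma ultra_infty_ultra : UltraFilter ultra_infty.
Proof. by rewrite /ultra_infty; case: cid => U []. Qed.

Lemma ultra_infty_oo : \oo `<=` ultra_infty.
Proof. by rewrite /ultra_infty; case: cid => U []. Qed.

#[local] Existing Instance ultra_infty_ultra.

Instance ultra_infty_proper : ProperFilter ultra_infty.
Proof. exact: ultra_proper. Qed.

Lemma ultra_fmap (T U : Type) (F : set_system T) (f : T -> U) :
  UltraFilter F -> UltraFilter (f x @[x --> F]).
Proof.
move=> FU; have PF : ProperFilter F by exact: ultra_proper.
apply: (Build_UltraFilter (fmap_proper_filter f PF)).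
move=> G PG FG; apply/seteqP; split=> [A GA|]; last exact: FG.
have [//|nA] := in_ultra_setVsetC (f @^-1` A) FU.
have /FG GnA : (f x @[x --> F]) (~` A) by [].
have G0 : G set0 by rewrite -(setICr A); exact: filterI.
by case: (filter_ex G0).
Qed.

Lemma ultra_infty_cvg (R : realType) (u : nat -> R) (a b : R) :
  (forall n, a <= u n <= b) -> cvg (u n @[n --> ultra_infty]).
Proof.
move=> uab; have := @segment_compact R a b; rewrite compact_ultra.
move=> /(_ _ (ultra_fmap u ultra_infty_ultra)) [].
  by apply: nearW => n /=; rewrite in_itv/=.
by move=> l [_ ul]; apply/cvg_ex; exists l.
Qed.

Lemma cvg_ultra_infty (T : topologicalType) (u : nat -> T) (l : T) :
  u n @[n --> \oo] --> l -> u n @[n --> ultra_infty] --> l.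
Proof. by move=> ul A /ul; exact: ultra_infty_oo. Qed.

End ultralimits.
#[global] Existing Instance ultra_infty_proper.

(** * Limits of inequalities and of finite sums *)

Section limit_helpers.
Variable R : realType.

Lemma cvg_le_cst (F : set_system nat) {FF : ProperFilter F} (u : nat -> R)
    (l b : R) :
  u n @[n --> F] --> l -> (\forall n \near F, u n <= b) -> l <= b.
Proof.
by move=> ul ub; exact: (closed_cvg (fun y => y <= b) (@closed_le R b) ub l ul).
Qed.

Lemma cvg_ge_cst (F : set_system nat) {FF : ProperFilter F} (u : nat -> R)
    (l b : R) :
  u n @[n --> F] --> l -> (\forall n \near F, b <= u n) -> b <= l.
Proof.
by move=> ul ub; exact: (closed_cvg (fun y => b <= y) (@closed_ge R b) ub l ul).
Qed.

Lemma cvg_dist_le (F : set_system nat) {FF : ProperFilter F} (u v : nat -> R)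
    (l m b : R) :
  u n @[n --> F] --> l -> v n @[n --> F] --> m ->
  (\forall n \near F, `|u n - v n| <= b) -> `|l - m| <= b.
Proof.
by move=> ul vm; apply: cvg_le_cst; apply: cvg_norm; exact: cvgB.
Qed.

Lemma cvg_sumC (I : finType) (F : set_system nat) {FF : Filter F}
    (u : I -> nat -> R[i]) (l : I -> R[i]) :
  (forall i, (u i n : R[i]^o) @[n --> F] --> (l i : R[i]^o)) ->
  (\sum_i u i n : R[i]^o) @[n --> F] --> (\sum_i l i : R[i]^o).
Proof.
by move=> ul; apply: cvg_big => [|i _]; [exact: add_continuous|exact: ul].
Qed.

Lemma cvg_sumR (I : finType) (F : set_system nat) {FF : Filter F}
    (u : I -> nat -> R) (l : I -> R) :
  (forall i, u i n @[n --> F] --> l i) ->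
  \sum_i u i n @[n --> F] --> \sum_i l i.
Proof.
by move=> ul; apply: cvg_big => [|i _]; [exact: add_continuous|exact: ul].
Qed.

End limit_helpers.

(** * Distribution functions of the weights *)

Section distribution.
Variable R : realType.
Implicit Types (c : nat -> nat -> R[i]) (t : R) (g : R -> R).

Definition weight_cdf c N t : R :=
  \sum_(l < 2 * N.+1) complex.Re (weight c N l) * (node R N.+1 l <= t)%R%:R.

Definition Re_weighted_sum c g N : R :=
  \sum_(l < 2 * N.+1) g (node R N.+1 l) * complex.Re (weight c N l).

Lemma Re_weight_ge0 c N l : positive_analytic c ->
    0 <= complex.Re (weight c N l).
Proof.
by move=> [cp _ _]; have := weight_ge0 N l cp; rewrite lecE => /andP[].
Qed.

Lemma weightE c N l : positive_analytic c ->
  weight c N l = (complex.Re (weight c N l))%:C.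
Proof.
move=> [cp _ _]; have := weight_ge0 N l cp.
by case: (weight c N l) => a b; rewrite lecE /= => /andP[/eqP ->].
Qed.

Lemma sum_Re_weight c N : positive_analytic c ->
  \sum_(l < 2 * N.+1) complex.Re (weight c N l) = complex.Re (c 0 0)%N.
Proof.
move=> cpa; rewrite -(weighted_sum1 N cpa) /weighted_sum
  (big_morph _ (@ReD R) erefl).
by apply: eq_bigr => l _; rewrite mul1r.
Qed.

Lemma weight_cdf_ge0 c N t : positive_analytic c -> 0 <= weight_cdf c N t.
Proof.
by move=> cpa; apply: sumr_ge0 => l _; rewrite mulr_ge0// Re_weight_ge0.
Qed.

Lemma weight_cdf_le c N t : positive_analytic c ->
    weight_cdf c N t <= complex.Re (c 0 0)%N.
Proof.
move=> cpa; rewrite -(sum_Re_weight N cpa); apply: ler_sum => l _.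
by rewrite ler_piMr ?Re_weight_ge0// lern1 leq_b1.
Qed.

Lemma weight_cdf_nondecreasing c N : positive_analytic c ->
    {homo weight_cdf c N : s t / s <= t}.
Proof.
move=> cpa s t st; apply: ler_sum => l _;
  rewrite ler_wpM2l ?Re_weight_ge0// ler_nat.
by case: (leP _ s) => // h; rewrite (le_trans h st).
Qed.

Lemma weight_cdf_lt0 c N t : t < 0 -> weight_cdf c N t = 0.
Proof.
move=> t0; rewrite /weight_cdf big1// => l _.
by rewrite leNgt (lt_le_trans t0 (node_ge0 _ _ _))//= mulr0.
Qed.

Lemma weight_cdf_ge2pi c N t : positive_analytic c -> 2 * pi <= t ->
  weight_cdf c N t = complex.Re (c 0 0)%N.
Proof.
move=> cpa t0; rewrite -(sum_Re_weight N cpa); apply: eq_bigr => l _.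
by rewrite (le_trans (ltW (node_lt2pi _ (ltn_ord l))) t0) mulr1.
Qed.

(** Every node lies in exactly one interval ]tau l, tau l.+1], where g is
    within e of g (s l). The tags s are independent of the endpoints tau, so
    that the endpoints can later be moved while the tags stay. *)
Lemma weight_cdf_riemann c N K (tau s : nat -> R) g e : positive_analytic c ->
  {homo tau : m n / (m <= n)%N >-> m <= n} ->
  tau 0%N < 0 -> 2 * pi <= tau K ->
  (forall l x, (l < K)%N -> tau l < x <= tau l.+1 -> `|g (s l) - g x| <= e) ->
  `|\sum_(l < K) g (s l) * (weight_cdf c N (tau l.+1) - weight_cdf c N (tau l))
    - Re_weighted_sum c g N| <= complex.Re (c 0 0)%N * e.
Proof.
move=> cpa tau_nd tau0 tauK gs.
(* the indicator of ]tau l, tau l.+1] at t *)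
pose D t l : R := (t <= tau l.+1)%R%:R - (t <= tau l)%R%:R.
have sumD j : \sum_(l < K) D (node R N.+1 j) l = (node R N.+1 j <= tau K)%R%:R.
  rewrite -(big_mkord xpredT (D _)) telescope_sumr//.
  by rewrite [node _ _ _ <= tau 0%N]leNgt
    (lt_le_trans tau0 (node_ge0 _ _ _))//= subr0.
rewrite (_ : _ - _ = \sum_(j < 2 * N.+1) complex.Re (weight c N j) *
    \sum_(l < K) (g (s l) - g (node R N.+1 j)) * D (node R N.+1 j) l);
      last first.
  under [RHS]eq_bigr => j _.
    rewrite (eq_bigr (fun l : 'I_K => g (s l) * D (node R N.+1 j) l -
       g (node R N.+1 j) * D (node R N.+1 j) l)); last by move=> l _;
         rewrite mulrBl.
    rewrite sumrB -mulr_sumr sumD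
      (le_trans (ltW (node_lt2pi _ (ltn_ord j))) tauK).
    rewrite mulr1 mulrBr [X in _ - X]mulrC; over.
  rewrite sumrB; congr (_ - _).
  under [RHS]eq_bigr do rewrite mulr_sumr.
  rewrite exchange_big /=; apply: eq_bigr => l _.
  rewrite /weight_cdf -sumrB mulr_sumr; apply: eq_bigr => j _; rewrite /D; ring.
rewrite -(sum_Re_weight N cpa) mulr_suml (le_trans (ler_norm_sum _ _ _))//.
apply: ler_sum => j _; rewrite normrM (ger0_norm (Re_weight_ge0 _ _ cpa)).
apply: ler_wpM2l; first exact: Re_weight_ge0.
have -> : e = \sum_(l < K) e * D (node R N.+1 j) l.
  by rewrite -mulr_sumr sumD (le_trans (ltW (node_lt2pi _ (ltn_ord j))) tauK)
    mulr1.
rewrite (le_trans (ler_norm_sum _ _ _))//; apply: ler_sum => l _.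
rewrite normrM /D; case: (leP _ (tau l)) => h1.
  by rewrite (le_trans h1 (tau_nd _ _ (leqnSn l))) subrr normr0 !mulr0.
case: (leP _ (tau l.+1)) => h2; last by rewrite subrr normr0 !mulr0.
by rewrite subr0 normr1 !mulr1 gs// h1.
Qed.

(** A limit along the common ultrafilter, hence linear in the kernel; see
    [limit_cdf_sum]. *)
Definition limit_cdf c t : R := lim (weight_cdf c N t @[N --> ultra_infty]).

Lemma limit_cdf_cvg c t : positive_analytic c ->
  weight_cdf c N t @[N --> ultra_infty] --> limit_cdf c t.
Proof.
move=> cpa; apply: (@ultra_infty_cvg R _ 0 (complex.Re (c 0 0)%N)) => N.
by rewrite weight_cdf_ge0// weight_cdf_le.
Qed.

Lemma limit_cdf_nondecreasing c : positive_analytic c ->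
    {homo limit_cdf c : s t / s <= t}.
Proof.
move=> cpa s t st; rewrite -subr_ge0.
apply: (@cvg_ge_cst R ultra_infty _ (fun N => weight_cdf c N t
  - weight_cdf c N s)).
  exact: (cvgB (limit_cdf_cvg cpa) (limit_cdf_cvg cpa)).
by apply: nearW => N; rewrite subr_ge0 weight_cdf_nondecreasing.
Qed.

Lemma limit_cdf_lt0 c t : t < 0 -> limit_cdf c t = 0.
Proof.
move=> t0; rewrite /limit_cdf; under eq_fun do rewrite weight_cdf_lt0//.
exact: lim_cst.
Qed.

Lemma limit_cdf_ge2pi c t : positive_analytic c -> 2 * pi <= t ->
  limit_cdf c t = complex.Re (c 0 0)%N.
Proof.
move=> cpa t0; rewrite /limit_cdf; under eq_fun do rewrite weight_cdf_ge2pi//.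
exact: lim_cst.
Qed.

Lemma limit_cdf_ge0 c t : positive_analytic c -> 0 <= limit_cdf c t.
Proof.
move=> cpa; apply: (cvg_ge_cst (limit_cdf_cvg cpa)).
by apply: nearW => N; exact: weight_cdf_ge0.
Qed.

Lemma limit_cdf_sum (I : finType) (x : I -> R[i])
    (cs : I -> nat -> nat -> R[i]) c t :
  positive_analytic c -> (forall i, positive_analytic (cs i)) ->
  (c = fun m n => \sum_i x i * cs i m n) ->
  (limit_cdf c t)%:C = \sum_i x i * (limit_cdf (cs i) t)%:C.
Proof.
move=> cpa cspa cE.
have weight_cdfE d N : positive_analytic d -> (weight_cdf d N t)%:C =
    \sum_(l < 2 * N.+1) weight d N l * (node R N.+1 l <= t)%R%:R.
  move=> dpa; rewrite rmorph_sum; apply: eq_bigr => l _.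
  by rewrite rmorphM /= -weightE// rmorph_nat.
have hC : ((weight_cdf c N t)%:C : R[i]^o) @[N --> ultra_infty] -->
  ((limit_cdf c t)%:C : R[i]^o).
  by apply: cvg_toC; exact: limit_cdf_cvg.
apply: (cvg_unique (@norm_hausdorff _ (R[i]^o)) hC).
rewrite (_ : (fun N => _) = fun N => \sum_i x i * (weight_cdf (cs i) N t)%:C :
  R[i]^o).
  by apply: cvg_sumC => i; apply: cvg_scaleC; apply: cvg_toC;
    exact: limit_cdf_cvg.
apply/funext => N; rewrite weight_cdfE// cE.
under eq_bigr do rewrite weight_sum mulr_suml.
rewrite exchange_big /=; apply: eq_bigr => i _.
by rewrite weight_cdfE// mulr_sumr; apply: eq_bigr => l _; rewrite mulrA.
Qed.

End distribution.

(** * The right-continuous limit distribution *)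

Section right_limit.
Variable R : realType.
Implicit Types (c : nat -> nat -> R[i]) (t : R) (g : R -> R).

Lemma near_invS_lt (e : R) : 0 < e -> \forall k \near \oo, k.+1%:R^-1 < e.
Proof. by move=> e0; exact: (near_infty_natSinv_lt (PosNum e0)). Qed.

(** The limit of the distribution functions need not be right-continuous,
    as a function generating a Stieltjes measure must be. *)
Definition right_cdf c t : R := lim (limit_cdf c (t + k.+1%:R^-1) @[k --> \oo]).

Lemma right_cdf_cvg c t : positive_analytic c ->
  limit_cdf c (t + k.+1%:R^-1) @[k --> \oo] --> right_cdf c t.
Proof.
move=> cpa; apply: nonincreasing_is_cvgn.
  move=> m n mn; apply: limit_cdf_nondecreasing => //.
  by rewrite lerD2l lef_pV2 ?posrE// ler_nat ltnS.
by exists 0 => _ [n _ <-]; exact: limit_cdf_ge0.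
Qed.

Lemma right_cdf_le_limit_cdf c s t : positive_analytic c -> s < t ->
    right_cdf c s <= limit_cdf c t.
Proof.
move=> cpa st; apply: (cvg_le_cst (right_cdf_cvg cpa)).
near=> k; apply: limit_cdf_nondecreasing => //.
rewrite -lerBrDl ltW//; near: k.
by apply: near_invS_lt; rewrite subr_gt0.
Unshelve. all: by end_near. Qed.

Lemma limit_cdf_le_right_cdf c t : positive_analytic c ->
    limit_cdf c t <= right_cdf c t.
Proof.
move=> cpa; apply: (cvg_ge_cst (right_cdf_cvg cpa)); apply: nearW => k.
by apply: limit_cdf_nondecreasing => //; rewrite lerDl invr_ge0.
Qed.

Lemma right_cdf_nondecreasing c : positive_analytic c ->
    {homo right_cdf c : s t / s <= t}.
Proof.
move=> cpa s t; rewrite le_eqVlt => /predU1P[->//|st].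
exact: le_trans (right_cdf_le_limit_cdf cpa st) (limit_cdf_le_right_cdf _ cpa).
Qed.

(** right_cdf is squeezed: right_cdf t <= right_cdf x <= limit_cdf s for
    t < x < s, and limit_cdf s is close to right_cdf t for some s > t. *)
Lemma right_cdf_right_continuous c : positive_analytic c ->
    right_continuous (right_cdf c).
Proof.
move=> cpa t; apply/cvgrPdist_lt => e e0.
have /cvgrPdist_lt/(_ _ e0)[k _ /(_ k (leqnn k))] := right_cdf_cvg (t := t) cpa.
rewrite distrC => /(le_lt_trans (ler_norm _)) Fk.
near=> x.
have tx : t < x by [].
rewrite distrC ger0_norm ?subr_ge0 ?right_cdf_nondecreasing ?(ltW tx)//.
apply: le_lt_trans Fk; rewrite lerD2r right_cdf_le_limit_cdf//.
by rewrite -ltrBlDl; near: x; apply: nbhs_right_ltDr; rewrite invr_gt0.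
Unshelve. all: by end_near. Qed.

Lemma right_cdf_lt0 c t : t < 0 -> right_cdf c t = 0.
Proof.
move=> t0; apply: (@cvg_lim _ (@norm_hausdorff _ R)).
have h : (fun k : nat => (0 : R)) @ \oo --> (0 : R) by exact: cvg_cst.
apply: cvg_near_eq h; near=> k.
rewrite limit_cdf_lt0// -ltrBrDl sub0r; near: k.
by apply: near_invS_lt; rewrite oppr_gt0.
Unshelve. all: by end_near. Qed.

Lemma right_cdf_ge2pi c t : positive_analytic c -> 2 * pi <= t ->
  right_cdf c t = complex.Re (c 0 0)%N.
Proof.
move=> cpa t0; apply: (@cvg_lim _ (@norm_hausdorff _ R)).
under eq_fun do rewrite limit_cdf_ge2pi ?ler_wpDr ?invr_ge0//.
exact: cvg_cst.
Qed.

Lemma right_cdf_sum (I : finType) (x : I -> R[i])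
    (cs : I -> nat -> nat -> R[i]) c t :
  positive_analytic c -> (forall i, positive_analytic (cs i)) ->
  (c = fun m n => \sum_i x i * cs i m n) ->
  (right_cdf c t)%:C = \sum_i x i * (right_cdf (cs i) t)%:C.
Proof.
move=> cpa cspa cE.
have hC : ((limit_cdf c (t + k.+1%:R^-1))%:C : R[i]^o) @[k --> \oo] -->
  ((right_cdf c t)%:C : R[i]^o).
  by apply: cvg_toC; exact: right_cdf_cvg.
apply: (cvg_unique (@norm_hausdorff _ (R[i]^o)) hC).
rewrite (_ : (fun k => _) =
  fun k => \sum_i x i * (limit_cdf (cs i) (t + k.+1%:R^-1))%:C : R[i]^o).
  by apply: cvg_sumC => i; apply: cvg_scaleC; apply: cvg_toC;
    exact: right_cdf_cvg.
by apply/funext => k; exact: limit_cdf_sum.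
Qed.

Lemma limit_cdf_riemann c K (tau s : nat -> R) g (e gamma : R) :
    positive_analytic c ->
  {homo tau : m n / (m <= n)%N >-> m <= n} ->
  tau 0%N < 0 -> 2 * pi <= tau K ->
  (forall l x, (l < K)%N -> tau l < x <= tau l.+1 -> `|g (s l) - g x| <= e) ->
  Re_weighted_sum c g @ \oo --> gamma ->
  `|\sum_(l < K) g (s l) * (limit_cdf c (tau l.+1) - limit_cdf c (tau l))
    - gamma| <= complex.Re (c 0 0)%N * e.
Proof.
move=> cpa tau_nd tau0 tauK gs wg.
apply: (@cvg_dist_le R ultra_infty _
  (fun N => \sum_(l < K) g (s l)
    * (weight_cdf c N (tau l.+1) - weight_cdf c N (tau l)))
  (Re_weighted_sum c g)).
- apply: cvg_sumR => l; apply: cvgMl_tmp.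
  exact: (cvgB (limit_cdf_cvg cpa) (limit_cdf_cvg cpa)).
- exact: cvg_ultra_infty.
- by apply: nearW => N; exact: weight_cdf_riemann.
Qed.

(** The values of right_cdf at the endpoints are limits of those of
    limit_cdf at endpoints moved to the right by a small amount, with the same
    tags. So the endpoints need not be continuity points of the limit. *)
Lemma right_cdf_riemann c K (s : nat -> R) g (e d gamma : R) :
    positive_analytic c ->
  {homo s : m n / (m <= n)%N >-> m <= n} ->
  s 0%N < 0 -> 2 * pi <= s K -> 0 < d ->
  (forall l x, (l < K)%N -> s l < x <= s l.+1 + d -> `|g (s l) - g x| <= e) ->
  Re_weighted_sum c g @ \oo --> gamma ->
  `|\sum_(l < K) g (s l) * (right_cdf c (s l.+1) - right_cdf c (s l))
    - gamma| <= complex.Re (c 0 0)%N * e.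
Proof.
move=> cpa s_nd s0 sK d0 gs wg.
apply: (@cvg_dist_le R \oo _
  (fun k => \sum_(l < K) g (s l)
    * (limit_cdf c (s l.+1 + k.+1%:R^-1) - limit_cdf c (s l + k.+1%:R^-1)))
  (fun=> gamma)).
- apply: cvg_sumR => l; apply: cvgMl_tmp.
  exact: (cvgB (right_cdf_cvg cpa) (right_cdf_cvg cpa)).
- exact: cvg_cst.
- near=> k; apply: (@limit_cdf_riemann c K (fun l => s l
  + k.+1%:R^-1) s g e gamma) => //.
  + by move=> m n mn; rewrite lerD2r s_nd.
  + rewrite -ltrBrDl sub0r; near: k.
    by apply: near_invS_lt; rewrite oppr_gt0.
  + by rewrite ler_wpDr// invr_ge0.
  + move=> l x lK /andP[h1 h2]; apply: gs => //; apply/andP; split.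
      by apply: le_lt_trans h1; rewrite lerDl invr_ge0.
    apply: (le_trans h2); rewrite lerD2l ltW//; near: k.
    exact: near_invS_lt.
Unshelve. all: by end_near. Qed.

Definition mesh n : R := 2 * pi / n.+1%:R.

(** The grid starts to the left of 0, so that its half-open intervals also
    cover an atom at 0. *)
Definition grid n l : R := l%:R * mesh n - mesh n.

Lemma mesh_gt0 n : 0 < mesh n.
Proof. by rewrite /mesh divr_gt0 ?mulr_gt0 ?pi_gt0. Qed.

Lemma grid0 n : grid n 0 = - mesh n.
Proof. by rewrite /grid mul0r sub0r. Qed.

Lemma gridS n l : grid n l.+1 = grid n l + mesh n.
Proof. by rewrite /grid -natr1; ring. Qed.

Lemma grid_last n : grid n n.+2 = 2 * pi.
Proof.
rewrite gridS /grid subrK /mesh; have : n.+1%:R != 0 :> R by rewrite pnatr_eq0.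
by move=> h; field.
Qed.

Lemma grid_nd n : {homo grid n : l m / (l <= m)%N >-> l <= m}.
Proof. by move=> l m lm; rewrite lerD2r ler_wpM2r ?ler_nat// ltW ?mesh_gt0. Qed.

Lemma cvg_mesh : mesh n @[n --> \oo] --> (0 : R).
Proof.
have h : (2 * pi * harmonic n : R) @[n --> \oo] --> (2 * pi * 0 : R).
  by apply: cvgMl_tmp; exact: cvg_harmonic.
by rewrite mulr0 in h.
Qed.

Lemma right_cdf_riemann_cvg c g (gamma : R) : positive_analytic c ->
    bounded_lipschitz g ->
  Re_weighted_sum c g @ \oo --> gamma ->
  \sum_(l < n.+2) g (grid n l)
    * (right_cdf c (grid n l.+1) - right_cdf c (grid n l))
    @[n --> \oo] --> gamma.
Proof.
move=> cpa [B gB gL] wg; apply: cvg_sub0 (cvg_cst gamma).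
have B0 : 0 <= B by apply: le_trans (gB 0).
have c0 : 0 <= complex.Re (c 0 0)%N.
  by rewrite -(sum_Re_weight 0 cpa) sumr_ge0// => l _; exact: Re_weight_ge0.
apply/norm_cvg0P.
have h : (complex.Re (c 0 0)%N * (B * (mesh n + mesh n))) @[n --> \oo] -->
    (complex.Re (c 0 0)%N * (B * (0 + 0)) : R).
  by apply: cvgMl_tmp; apply: cvgMl_tmp; exact: (cvgD cvg_mesh cvg_mesh).
rewrite addr0 !mulr0 in h.
apply: (@squeeze_cvgr _ _ _ _ (fun=> 0) (fun n => complex.Re (c 0 0)%N
  * (B * (mesh n + mesh n)))) => //; last exact: cvg_cst.
apply: nearW => n; rewrite normr_ge0 /=.
apply: (@right_cdf_riemann c n.+2 (grid n) g _ (mesh n)) => //.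
- exact: grid_nd.
- by rewrite grid0 oppr_lt0 mesh_gt0.
- by rewrite grid_last.
- exact: mesh_gt0.
move=> l x _ /andP[h1 h2]; apply: (le_trans (gL _ _)); apply: ler_wpM2l => //.
by rewrite distrC ger0_norm ?subr_ge0 ?(ltW h1)// lerBlDl addrA -gridS.
Qed.

Lemma right_cdf_riemann_cvgC c (g : R -> R[i]) (gamma : R[i]) :
    positive_analytic c -> bounded_lipschitzC g ->
  weighted_sum c g @ \oo --> (gamma : R[i]^o) ->
  (\sum_(l < n.+2) g (grid n l)
    * (right_cdf c (grid n l.+1) - right_cdf c (grid n l))%:C : R[i]^o)
    @[n --> \oo] --> (gamma : R[i]^o).
Proof.
move=> cpa [gr gi] wg.
have reE (K : nat) (h : 'I_K -> R[i]) (w : 'I_K -> R) :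
    complex.Re (\sum_i h i * (w i)%:C) = \sum_i complex.Re (h i) * w i.
  rewrite (big_morph _ (@ReD R) erefl); apply: eq_bigr => i _.
  by rewrite complexReM /= mulr0 subr0.
have imE (K : nat) (h : 'I_K -> R[i]) (w : 'I_K -> R) :
    complex.Im (\sum_i h i * (w i)%:C) = \sum_i complex.Im (h i) * w i.
  rewrite (big_morph _ (@ImD R) erefl); apply: eq_bigr => i _.
  by rewrite complexImM /= mulr0 add0r.
have wE : weighted_sum c g = (fun N => \sum_(l < 2 * N.+1)
     g (node R N.+1 l) * (complex.Re (weight c N l))%:C).
  by apply/funext => N; apply: eq_bigr => l _; rewrite -weightE.
rewrite wE in wg.
apply: cvg_ReIm.
  under eq_fun do rewrite reE.
  apply: (@right_cdf_riemann_cvg c (fun x => complex.Re (g x))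
    (complex.Re gamma)) => //.
  by have := cvg_Re wg; under eq_fun do rewrite reE.
under eq_fun do rewrite imE.
apply: (@right_cdf_riemann_cvg c (fun x => complex.Im (g x))
  (complex.Im gamma)) => //.
by have := cvg_Im wg; under eq_fun do rewrite imE.
Qed.

End right_limit.

(** * Riemann sums for integrals *)

Section riemann_integral.
Variable R : realType.
Local Notation T := (measurableTypeR R).

Lemma bounded_lipschitz_integrable (mu : {finite_measure set T -> \bar R})
    (D : set T) (g : R -> R) :
  measurable D -> bounded_lipschitz g -> mu.-integrable D (EFin \o g).
Proof.
move=> mD gb; have [B gB gL] := gb.
apply: (@measurable_bounded_integrable _ T R mu g D) => //.
- by rewrite ltey_eq fin_num_measure.
- apply: measurable_realfun.subspace_continuous_measurable_fun => //.
  exact/continuous_subspaceT/bounded_lipschitz_continuous.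
- exists B; split; first exact: num_real.
  by move=> x Bx y _ /=; exact: le_trans (gB y) (ltW Bx).
Qed.

Lemma Rintegral_riemann (mu : {finite_measure set T -> \bar R}) (D : set T)
    (g : R -> R) (s : nat -> R) K (e : R) :
  measurable D -> bounded_lipschitz g ->
    {homo s : m n / (m <= n)%N >-> m <= n} ->
  (forall l x, (l < K)%N -> s l < x <= s l.+1 -> `|g (s l) - g x| <= e) ->
  `|Rintegral mu (D `&` `]s 0%N, s K]) g
    - \sum_(l < K) g (s l) * fine (mu (D `&` `]s l, s l.+1]))|
  <= e * fine (mu (D `&` `]s 0%N, s K])).
Proof.
move=> mD gb s_nd; elim: K => [|K IHK] gs.
  rewrite big_ord0 set_itv_ge ?bnd_simp ?ltxx// setI0 measure0 Rintegral_set0.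
  by rewrite subr0 normr0 mulr0.
have mI a b : measurable (D `&` `]a, b] : set T) by exact: measurableI.
have split_itv : D `&` `]s 0%N, s K.+1] =
    (D `&` `]s 0%N, s K]) `|` (D `&` `]s K, s K.+1]).
  by rewrite -setIUr -itv_bndbnd_setU ?bnd_simp ?s_nd.
have disj : [disjoint D `&` `]s 0%N, s K] & D `&` `]s K, s K.+1]].
  apply/disj_setPS => x [[_ /=]]; rewrite in_itv/= => /andP[_ h1] [_ /=].
  rewrite in_itv/= => /andP[h2 _].
  by move: h2; rewrite ltNge h1.
rewrite split_itv Rintegral_setU//; last first.
  by apply: bounded_lipschitz_integrable => //; exact: measurableU.
rewrite measureU//; last exact/disj_set2P.
rewrite fineD ?fin_num_measure// mulrDr big_ord_recr /= opprD addrACA.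
rewrite (le_trans (ler_normD _ _))// lerD//.
  by apply: IHK => l x lK; apply: gs; exact: ltnW.
have -> : g (s K) * fine (mu (D `&` `]s K, s K.+1])) =
    Rintegral mu (D `&` `]s K, s K.+1]) (fun=> g (s K)) by
      rewrite Rintegral_cst.
have cb : bounded_lipschitz (fun=> g (s K)) := bounded_lipschitz_cst (g (s K)).
rewrite -RintegralB//; [|exact: bounded_lipschitz_integrable..].
have db : bounded_lipschitz (fun x => g x - g (s K))
  by apply: bounded_lipschitzD => //; exact: bounded_lipschitz_cst.
rewrite (le_trans (le_normr_Rintegral _ _))//;
  first exact: bounded_lipschitz_integrable.
rewrite -Rintegral_cst//; apply: le_Rintegral => //.
- apply: (@bounded_lipschitz_integrable mu _ (fun x => `|g x - g (s K)|)) => //.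
  have [B gB gL] := db; exists B => [x|x y]; first by rewrite normr_id.
  exact: le_trans (ler_dist_dist _ _) (gL x y).
- by apply: bounded_lipschitz_integrable => //; exact: bounded_lipschitz_cst.
- by move=> x [_ /=]; rewrite in_itv/= => sx; rewrite distrC; exact: gs.
Qed.

(** The constant is the total variation of nu on D: the error is that of
    the two parts of the Jordan decomposition. *)
Lemma charge_integral_riemann (nu : {charge set T -> \bar R}) (D : set T) :
  measurable D -> exists C : R, forall (g : R -> R) (s : nat -> R) K (e : R),
  bounded_lipschitz g -> {homo s : m n / (m <= n)%N >-> m <= n} ->
    D `<=` `]s 0%N, s K] ->
  (forall l x, (l < K)%N -> s l < x <= s l.+1 -> `|g (s l) - g x| <= e) ->
  `|charge_integral nu D g
    - \sum_(l < K) g (s l) * fine (nu (D `&` `]s l, s l.+1]))| <= C * e.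
Proof.
move=> mD; rewrite /charge_integral.
set P := cid (Hahn_decomposition nu); set N := cid (projT2 P).
pose pos : {finite_measure set T -> \bar R} := jordan_pos (projT2 N).
pose neg : {finite_measure set T -> \bar R} := jordan_neg (projT2 N).
exists (fine (pos D) + fine (neg D)) => g s K e gb s_nd Ds gs.
have DE : D `&` `]s 0%N, s K] = D by exact/setIidPl.
have := @Rintegral_riemann pos D g s K e mD gb s_nd gs.
have := @Rintegral_riemann neg D g s K e mD gb s_nd gs.
rewrite DE => hneg hpos.
have nuE A : measurable A -> fine (nu A) = fine (pos A) - fine (neg A).
  move=> mA; rewrite (jordan_decomp (projT2 N) mA) /cadd /= cscaleN1 -/pos
    -/neg.
  by rewrite -fineN -fineD ?fin_numN ?(@fin_num_measure _ _ _ pos)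
    ?(@fin_num_measure _ _ _ neg).
have mI a b : measurable (D `&` `]a, b] : set T) by exact: measurableI.
under eq_bigr do rewrite nuE// mulrBr.
rewrite sumrB.
rewrite [X in `|X|](_ : _ = (Rintegral pos D g -
    \sum_(l < K) g (s l) * fine (pos (D `&` `]s l, s l.+1])))
  - (Rintegral neg D g -
    \sum_(l < K) g (s l) * fine (neg (D `&` `]s l, s l.+1])))); last first.
  by rewrite /pos /neg; ring.
by rewrite (le_trans (ler_normB _ _))// mulrDl lerD// mulrC.
Qed.

Lemma charge_integral_cvg (nu : {charge set T -> \bar R}) (g : R -> R) :
  bounded_lipschitz g ->
  \sum_(l < n.+2) g (grid R n l) *
    fine (nu (`[0, 2 * pi] `&` `]grid R n l, grid R n l.+1])) @[n --> \oo]
  --> charge_integral nu `[0, 2 * pi] g.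
Proof.
move=> gb; have [B gB gL] := gb.
have B0 : 0 <= B by apply: le_trans (gB 0).
have [|C hC] := @charge_integral_riemann nu `[0, 2 * pi] _;
  first exact: measurable_itv.
apply: cvg_sub0 (cvg_cst (charge_integral nu `[0, 2 * pi] g)).
apply/norm_cvg0P.
have h : (C * (B * mesh R n)) @[n --> \oo] --> (C * (B * 0) : R).
  by apply: cvgMl_tmp; apply: cvgMl_tmp; exact: cvg_mesh.
rewrite !mulr0 in h.
apply: (@squeeze_cvgr _ _ _ _ (fun=> 0) (fun n => C * (B * mesh R n))) => //;
  last exact: cvg_cst.
apply: nearW => n; rewrite normr_ge0 /= distrC; apply: hC => //.
- exact: grid_nd.
- move=> x /=; rewrite !in_itv /= grid0 grid_last => /andP[x0 ->];
  rewrite andbT.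
  by rewrite (lt_le_trans _ x0)// oppr_lt0 mesh_gt0.
move=> l x _ /andP[h1 h2]; apply: (le_trans (gL _ _)); apply: ler_wpM2l => //.
by rewrite distrC ger0_norm ?subr_ge0 ?(ltW h1)// lerBlDl -gridS.
Qed.

(** Riemann sums involve only the values of M, whereas the integral goes
    through the Jordan decompositions of the parts of each entry. Linearity and
    positivity of the integral are read off from this limit. *)
Lemma mxmeas_integral_cvg p (M : posmxmeasure T R p) (g : R -> R[i]) j k :
  bounded_lipschitzC g ->
  (\sum_(l < n.+2) g (grid R n l) *
    M (`[0, 2 * pi] `&` `]grid R n l, grid R n l.+1]) j k : R[i]^o) @[n --> \oo]
  --> (mxmeas_integral M `[0, 2 * pi] g j k : R[i]^o).
Proof.
move=> [gr gi]; rewrite mxE /complex_integral.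
apply: cvg_ReIm => /=.
  rewrite (_ : (fun n => _) = (fun n =>
    \sum_(l < n.+2) complex.Re (g (grid R n l)) *
    fine (mxmeas_Re M j k (`[0, 2 * pi] `&` `]grid R n l, grid R n l.+1]))
    - \sum_(l < n.+2) complex.Im (g (grid R n l)) *
    fine (mxmeas_Im M j k (`[0, 2 * pi] `&` `]grid R n l, grid R n l.+1])))).
    exact: (cvgB (charge_integral_cvg (nu := mxmeas_Re M j k) gr)
                 (charge_integral_cvg (nu := mxmeas_Im M j k) gi)).
  apply/funext => n; rewrite (big_morph _ (@ReD R) erefl) -sumrB.
  by apply: eq_bigr => l _; rewrite complexReM.
rewrite (_ : (fun n => _) = (fun n =>
    \sum_(l < n.+2) complex.Re (g (grid R n l)) *
    fine (mxmeas_Im M j k (`[0, 2 * pi] `&` `]grid R n l, grid R n l.+1]))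
    + \sum_(l < n.+2) complex.Im (g (grid R n l)) *
    fine (mxmeas_Re M j k (`[0, 2 * pi] `&` `]grid R n l, grid R n l.+1])))).
  exact: (cvgD (charge_integral_cvg (nu := mxmeas_Im M j k) gr)
               (charge_integral_cvg (nu := mxmeas_Re M j k) gi)).
apply/funext => n; rewrite (big_morph _ (@ImD R) erefl) -big_split.
by apply: eq_bigr => l _; rewrite complexImM.
Qed.

End riemann_integral.

(** * Quadratic forms and polarization *)

Section quadratic_forms.
Variable R : realType.

Definition qform n (A : 'M[R[i]]_n) (x : 'I_n -> R[i]) : R[i] :=
  \sum_j \sum_k (x j)^* * A j k * x k.

Lemma qformE n (A : 'M[R[i]]_n) (v : 'cV[R[i]]_n) :
  ((v ^t Num.conj)%sesqui *m A *m v) 0 0 = qform A (v^~ 0).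
Proof.
rewrite mxE /qform exchange_big /=; apply: eq_bigr => k _.
rewrite mxE mulr_suml; apply: eq_bigr => j _.
by rewrite !mxE.
Qed.

(** The powers of i, listed so that they compute. *)
Definition fourth_root s : R[i] := nth 0 [:: 1; 'i%C; -1; - 'i%C] s.

Definition polar_vec n (j k : 'I_n) (s : nat) (l : 'I_n) : R[i] :=
  (l == j)%:R + fourth_root s * (l == k)%:R.

Lemma sum_delta2 n (F : 'I_n -> R[i]) j k z :
  \sum_l F l * ((l == j)%:R + z * (l == k)%:R) = F j + z * F k.
Proof.
under eq_bigr do rewrite mulrDr.
rewrite big_split /= (bigD1 j)//= big1 ?addr0; last first.
  by move=> i /negbTE ->; rewrite mulr0.
rewrite (bigD1 k)//= big1 ?addr0; last first.
  by move=> i /negbTE ->; rewrite !mulr0.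
by rewrite !eqxx !mulr1 mulrC.
Qed.

Lemma qform_polar_vec n (A : 'M[R[i]]_n) j k s :
  qform A (polar_vec j k s) = A j j + fourth_root s * A j k +
    (fourth_root s)^* * (A k j + fourth_root s * A k k).
Proof.
set z := fourth_root s.
rewrite /qform -(@sum_delta2 _ (fun l => A l j + z * A l k) j k z^*).
apply: eq_bigr => l _; rewrite /polar_vec -/z sum_delta2.
by rewrite rmorphD rmorphM /= !rmorph_nat; ring.
Qed.

(** Summed against conj(z)/4 over the fourth roots of unity z, the terms
    of the form at e_j + z e_k have coefficients that average to 0, except for
    z A j k. *)
Lemma polarization n (A : 'M[R[i]]_n) j k :
  A j k = \sum_(s < 4) (fourth_root s)^* / 4 * qform A (polar_vec j k s).
Proof.
rewrite !big_ord_recl big_ord0 !qform_polar_vec /fourth_root /=.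
rewrite !rmorphN rmorph1 /= !conjC_i.
have i2 := sqr_i R.
transitivity (((2 - 2 * 'i%C ^+ 2) * A j k + (2 + 2 * 'i%C ^+ 2) * A k j) / 4).
  by rewrite i2; field.
by field.
Qed.

(** Hermitian symmetry is a consequence of positivity over R[i]: the form of
    A - A^* vanishes since that of A is real, so A - A^* = 0 by polarization. *)
Lemma possemidefP n (A : 'M[R[i]]_n) :
  possemidef A <-> forall x, 0 <= qform A x.
Proof.
split=> [[_ Ap] x|Ap].
  have := Ap (\col_j x j); rewrite qformE.
  by congr (0 <= _); apply: eq_bigr => j _; apply: eq_bigr => k _; rewrite !mxE.
split; last by move=> v; rewrite qformE.
apply/is_hermitianmxP; rewrite expr0 scale1r; apply/matrixP => j k;
  rewrite !mxE.
pose B : 'M[R[i]]_n := \matrix_(j, k) (A j k - (A k j)^*).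
have qB x : qform B x = 0.
  transitivity (qform A x - (qform A x)^*); last first.
    by rewrite (geC0_conj (Ap x)) subrr.
  rewrite /qform rmorph_sum /= [X in _ = _ - X](_ : _ =
      \sum_j \sum_k (x j)^* * (A k j)^* * x k); last first.
    under eq_bigr do rewrite rmorph_sum /=.
    rewrite exchange_big /=; apply: eq_bigr => i _; apply: eq_bigr => l _.
    by rewrite !rmorphM /= conjCK; ring.
  rewrite -sumrB; apply: eq_bigr => i _; rewrite -sumrB; apply: eq_bigr => l _.
  by rewrite mxE; ring.
have := polarization B j k; rewrite big1 => [|s _]; last by rewrite qB mulr0.
by rewrite mxE => /eqP; rewrite subr_eq0 => /eqP.
Qed.

Lemma finite_section_form p (f : nat -> nat -> 'M[R[i]]_p) N
    (x : 'I_N.+1 -> 'I_p -> R[i]) (v := \mxcol_m (\col_j x m j)) :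
  ((v ^t Num.conj)%sesqui *m finite_section f N *m v) 0 0 =
  \sum_(m < N.+1) \sum_(n < N.+1) \sum_(j < p) \sum_(k < p) (x m j)^*
    * f m n j k * x n k.
Proof.
have -> : (v ^t Num.conj)%sesqui =
  \mxrow_m (((\col_j x m j) : 'cV[R[i]]_p) ^t Num.conj)%sesqui.
  by rewrite /v tr_mxcol; apply/matrixP => i j; rewrite !mxE.
rewrite /finite_section mul_mxrow_mxblock mul_mxrow_mxcol summxE.
rewrite exchange_big /=; apply: eq_bigr => n _.
rewrite mulmx_suml summxE; apply: eq_bigr => m _.
rewrite mxE exchange_big /=; apply: eq_bigr => k _.
rewrite !mxE mulr_suml; apply: eq_bigr => j _.
by rewrite !mxE.
Qed.

Lemma possemidef_finite_sectionP p (f : nat -> nat -> 'M[R[i]]_p) N :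
  possemidef (finite_section f N) <-> forall x : 'I_N.+1 -> 'I_p -> R[i],
    0 <= \sum_(m < N.+1) \sum_(n < N.+1) \sum_(j < p) \sum_(k < p) (x m j)^*
      * f m n j k * x n k.
Proof.
split=> [[_ fp] x|fp]; first by rewrite -finite_section_form fp.
apply/possemidefP => x; pose v := \col_l x l.
have -> : qform (finite_section f N) x = qform (finite_section f N) (v^~ 0).
  by congr qform; apply/funext => l; rewrite mxE.
rewrite -qformE.
have -> : v = \mxcol_m (\col_j submxcol v m j 0).
  rewrite -[LHS]submxcolK; apply/eq_mxcolP => m; apply/matrixP => j k.
  by rewrite [in RHS]mxE ord1.
by rewrite finite_section_form fp.
Qed.

End quadratic_forms.

(** * Moments of a matrix measure *)

Section sufficiency.
Variable R : realType.
Local Notation T := (measurableTypeR R).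

Lemma cvg_ge0C (u : nat -> R[i]) (l : R[i]) :
  (u : nat -> R[i]^o) @ \oo --> (l : R[i]^o) -> (forall n, 0 <= u n) -> 0 <= l.
Proof.
move=> ul u0; rewrite lecE; apply/andP; split; last first.
  apply: (cvg_ge_cst (cvg_Re ul)); apply: nearW => n.
  by have := u0 n; rewrite lecE => /andP[].
have h := cvg_Im ul.
have imE : (fun n => complex.Im (u n)) = fun=> 0.
  by apply/funext => n; have := u0 n; rewrite lecE => /andP[/eqP].
rewrite imE in h.
by apply/eqP; apply: (cvg_unique (@norm_hausdorff _ R) h); exact: cvg_cst.
Qed.

(** The form of the section is a limit of sums over l of the forms of
    M(I_l) at the vectors y l = sum_n b(t_l)^n x_n. *)
Lemma moments_possemidef p (M : posmxmeasure T R p)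
    (f : nat -> nat -> 'M[R[i]]_p) :
  (forall m n, f m n = ((2 * pi)^-1)%:C *:
    mxmeas_integral M `[0, 2 * pi]
      (fun t => cosymbol t ^+ m * symbol t ^+ n)) ->
  forall N, possemidef (finite_section f N).
Proof.
move=> fE N; apply/possemidef_finite_sectionP => x.
pose S L : R[i] := \sum_(m < N.+1) \sum_(n < N.+1) \sum_(j < p) \sum_(k < p)
  (x m j)^* * x n k * ((2 * pi)^-1)%:C *
  \sum_(l < L.+2) (cosymbol (grid R L l) ^+ m * symbol (grid R L l) ^+ n) *
    M (`[0, 2 * pi] `&` `]grid R L l, grid R L l.+1]) j k.
apply: (@cvg_ge0C S).
  apply: cvg_sumC => m; apply: cvg_sumC => n; apply: cvg_sumC => j;
    apply: cvg_sumC => k.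
  rewrite fE mxE [X in _ --> X](_ : _ = (x m j)^* * x n k * ((2 * pi)^-1)%:C *
    mxmeas_integral M `[0, 2 * pi]
      (fun t => cosymbol t ^+ m * symbol t ^+ n) j k); last by ring.
  apply: cvg_scaleC; apply:
    (@mxmeas_integral_cvg R p M (fun t => cosymbol t ^+ m * symbol t ^+ n) j k).
  by apply: bounded_lipschitzCM; apply: bounded_lipschitzCX;
    [exact: bounded_lipschitzC_cosymbol|exact: bounded_lipschitzC_symbol].
move=> L.
pose y l k := \sum_(n < N.+1) symbol (grid R L l) ^+ nat_of_ord n * x n k :
  R[i].
have -> : S L = \sum_(l < L.+2) ((2 * pi)^-1)%:C *
    qform (M (`[0, 2 * pi] `&` `]grid R L l, grid R L l.+1])) (y l).
  transitivity (\sum_(l < L.+2) \sum_(m < N.+1) \sum_(n < N.+1) \sum_(j < p)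
    \sum_(k < p) ((2 * pi)^-1)%:C *
     ((x m j)^* * cosymbol (grid R L l) ^+ nat_of_ord m *
      M (`[0, 2 * pi] `&` `]grid R L l, grid R L l.+1]) j k *
      (symbol (grid R L l) ^+ nat_of_ord n * x n k))).
    rewrite [RHS]exchange_big; apply: eq_bigr => m _.
    rewrite [RHS]exchange_big; apply: eq_bigr => n _.
    rewrite [RHS]exchange_big; apply: eq_bigr => j _.
    rewrite [RHS]exchange_big; apply: eq_bigr => k _ /=.
    by rewrite mulr_sumr; apply: eq_bigr => l _; ring.
  apply: eq_bigr => l _; rewrite /qform mulr_sumr.
  under [RHS]eq_bigr do rewrite mulr_sumr.
  under [LHS]eq_bigr do rewrite exchange_big.
  rewrite exchange_big; apply: eq_bigr => j _ /=.
  under [LHS]eq_bigr do rewrite exchange_big.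
  rewrite exchange_big; apply: eq_bigr => k _ /=.
  rewrite /y rmorph_sum /= !mulr_suml mulr_sumr; apply: eq_bigr => m _.
  rewrite !mulr_sumr; apply: eq_bigr => n _.
  rewrite rmorphM rmorphXn /= -conj_cosymbol conjCK.
  by rewrite !conj_cosymbol; ring.
apply: sumr_ge0 => l _; apply: mulr_ge0.
  by rewrite ler0c invr_ge0 mulr_ge0 ?pi_ge0.
apply: (possemidefP _).1; apply: mxmeas_possemidef.
by apply: measurableI; exact: measurable_itv.
Qed.

End sufficiency.

(** * Linear relations between finite measures *)

Section finite_measures.
Variable R : realType.
Local Notation T := (measurableTypeR R).

Lemma measure_fin (mu : {measure set T -> \bar R}) (A : set T) :
  (mu setT < +oo)%E -> measurable A -> mu A \is a fin_num.
Proof.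
move=> muT mA; rewrite ge0_fin_numE//; apply: le_lt_trans muT.
by apply: le_measure => //; rewrite inE.
Qed.

Lemma fine_sigma_additive (mu : {measure set T -> \bar R}) (F : (set T)^nat) :
  (mu setT < +oo)%E -> (forall n, measurable (F n)) -> trivIset setT F ->
  \sum_(0 <= l < n) fine (mu (F l)) @[n --> \oo] --> fine (mu (\bigcup_n F n)).
Proof.
move=> muT mF tF.
have mU : measurable (\bigcup_n F n) by exact: bigcupT_measurable.
have := @measure_semi_sigma_additive _ _ _ mu F mF tF mU.
rewrite -[X in _ --> X -> _]fineK; last exact: measure_fin.
move=> /fine_cvg; apply: cvg_trans; apply: near_eq_cvg; near=> n => /=.
by rewrite sum_fine// => l _; exact: measure_fin.
Unshelve. all: by end_near. Qed.

(** Dynkin: the half-open intervals are stable under intersection and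
    generate the Borel sets, and the relation is stable under complements (it
    holds for the whole line by exhaustion) and countable disjoint unions. *)
Lemma eq_comb_measure (I : finType) (nu : {measure set T -> \bar R})
    (mu : I -> {measure set T -> \bar R}) (r : I -> R[i]) :
  (nu setT < +oo)%E -> (forall i, (mu i setT < +oo)%E) ->
  (forall a b : R, a <= b -> (fine (nu `]a, b]))%:C =
     \sum_i r i * (fine (mu i `]a, b]%classic))%:C) ->
  forall A, measurable A -> (fine (nu A))%:C = \sum_i r i * (fine (mu i A))%:C.
Proof.
move=> nuT muT H.
have cvgU (F : (set T)^nat) (m : {measure set T -> \bar R}) :
  (m setT < +oo)%E ->
    (forall n, measurable (F n)) ->
      {homo F : n m / (n <= m)%N >-> (n <= m)%O} ->
    ((fine (m (F n)))%:C : R[i]^o) @[n --> \oo] -->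
      ((fine (m (\bigcup_n F n)))%:C : R[i]^o).
  move=> mT mF ndF; apply: cvg_toC.
  have mU : measurable (\bigcup_n F n) by exact: bigcupT_measurable.
  have := nondecreasing_cvg_mu (mu := m) mF mU ndF.
  rewrite -[X in _ --> X -> _]fineK; last exact: measure_fin.
  by move=> /fine_cvg.
have HT : (fine (nu setT))%:C = \sum_i r i * (fine (mu i setT))%:C.
  rewrite -(bigcup_itvT false false).
  set I' := fun n => _.
  have mI n : measurable (I' n : set T) by exact: measurable_itv.
  have ndI : {homo I' : n m / (n <= m)%N >-> (n <= m)%O}.
    by move=> m n mn; apply/subsetPset/subset_itv;
      rewrite leBSide/= ?lerN2 ler_nat.
  apply: (cvg_unique (@norm_hausdorff _ (R[i]^o)) (cvgU I' nu nuT mI ndI)).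
  rewrite (_ : (fun n => (fine (nu (I' n)))%:C) =
     fun n => \sum_i r i * (fine (mu i (I' n)))%:C : R[i]^o).
    by apply: cvg_sumC => i; apply: cvg_scaleC; exact: cvgU.
  by apply/funext => n; rewrite H// ge0_cp.
pose G : set (set T) := @ocitv R.
move=> A mA; apply: (@dynkin_induction _ T G
  [set A | (fine (nu A))%:C = \sum_i r i * (fine (mu i A))%:C]) => //=.
- by move=> X Y; exact: ocitvI.
- move=> X [[a b] /= ab <-].
  have [ab'|ab'] := leP a b; first exact: H.
  rewrite set_itv_ge ?bnd_simp -?leNgt ?(ltW ab')// measure0.
  by rewrite big1// => i _; rewrite measure0 mulr0.
- move=> S mS SE.
  have cE (m : {measure set T -> \bar R}) : (m setT < +oo)%E ->
      fine (m (~` S)) = fine (m setT) - fine (m S).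
    move=> mT; rewrite -setTD measureD ?setTI//.
    by rewrite fineB// measure_fin.
  rewrite cE// rmorphB /= HT SE -sumrB; apply: eq_bigr => i _.
  by rewrite cE// rmorphB /= mulrBr.
- move=> F mF tF FE.
  have h : ((\sum_(0 <= l < n) fine (nu (F l)))%:C : R[i]^o) @[n --> \oo] -->
      ((fine (nu (\bigcup_n F n)))%:C : R[i]^o).
    by apply: cvg_toC; exact: fine_sigma_additive.
  apply: (cvg_unique (@norm_hausdorff _ (R[i]^o)) h).
  rewrite (_ : (fun n => _) =
    fun n => \sum_i r i * (\sum_(0 <= l < n) fine (mu i (F l)))%:C : R[i]^o).
    by apply: cvg_sumC => i; apply: cvg_scaleC; apply: cvg_toC;
      exact: fine_sigma_additive.
  apply/funext => n; rewrite rmorph_sum /=.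
  under eq_bigr do rewrite FE.
  rewrite exchange_big /=; apply: eq_bigr => i _.
  by rewrite rmorph_sum mulr_sumr.
Qed.

Lemma lebesgue_stieltjes_itv (f : cumulative R R) (a b : R) : a <= b ->
  lebesgue_stieltjes_measure f `]a, b] = (f b - f a)%:E.
Proof.
move=> ab; rewrite /lebesgue_stieltjes_measure /measure_extension /=.
by rewrite measurable_mu_extE/= ?wlength_itv_bnd//; exact: is_ocitv.
Qed.

End finite_measures.

(** * The measure of a scalar kernel *)

Section kernel_measure.
Variable R : realType.
Local Notation T := (measurableTypeR R).
Variables (c : nat -> nat -> R[i]) (cpa : positive_analytic c).

Definition right_cdf_cumulative : cumulative R R :=
  HB.pack (right_cdf c) (isCumulative.Build R _ R (right_cdf c)
    (right_cdf_nondecreasing cpa) (right_cdf_right_continuous cpa)).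

Definition kernel_measure : {measure set T -> \bar R} :=
  lebesgue_stieltjes_measure right_cdf_cumulative.

Lemma kernel_measure_itv (a b : R) : a <= b ->
  kernel_measure `]a, b] = (right_cdf c b - right_cdf c a)%:E.
Proof. exact: lebesgue_stieltjes_itv. Qed.

Lemma kernel_measure_support : kernel_measure (~` `[0, 2 * pi]) = 0%E.
Proof.
(* an increasing sequence of null sets that exhausts the complement *)
pose F n : set T := `](- n.+1%:R), (- n.+1%:R^-1)] `|` `]2 * pi, 2 * pi + n%:R].
have mF n : measurable (F n) by apply: measurableU; exact: measurable_itv.
have F0 n : kernel_measure (F n) = 0%E.
  have n1 : n.+1%:R^-1 <= n.+1%:R :> R.
    by rewrite (@le_trans _ _ 1) ?invf_le1 ?ler1n ?ltr0n.
  have e1 : kernel_measure `](- n.+1%:R), (- n.+1%:R^-1)] = 0%E.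
    rewrite kernel_measure_itv ?lerN2//.
    by rewrite !right_cdf_lt0 ?oppr_lt0 ?invr_gt0 ?ltr0n// subrr.
  have e2 : kernel_measure `]2 * pi, 2 * pi + n%:R] = 0%E.
    by rewrite kernel_measure_itv ?lerDl// !right_cdf_ge2pi ?lerDl// subrr.
  apply/eqP; rewrite eq_le measure_ge0 andbT.
  apply: (le_trans (measureU2 _ _ _)); [exact: measurable_itv..|].
  by rewrite [X in (X + _)%E]e1 [X in (_ + X)%E]e2 adde0.
have ndF : {homo F : n m / (n <= m)%N >-> (n <= m)%O}.
  move=> m n mn; apply/subsetPset; apply: setUSS; apply: subset_itv;
    rewrite leBSide /=.
  - by rewrite lerN2 ler_nat.
  - by rewrite lerN2 lef_pV2 ?posrE// ler_nat.
  - by [].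
  - by rewrite lerD2l ler_nat.
have mU : measurable (\bigcup_n F n) by exact: bigcupT_measurable.
have U0 : kernel_measure (\bigcup_n F n) = 0%E.
  have := nondecreasing_cvg_mu (mu := kernel_measure) mF mU ndF.
  have -> : kernel_measure \o F = cst 0%E by apply/funext => n /=; exact: F0.
  by move=> h; apply: (cvg_unique (@ereal_hausdorff R) h); exact: cvg_cst.
apply/eqP; rewrite eq_le measure_ge0 andbT -U0.
apply: le_measure; rewrite ?inE//; first by apply: measurableC;
  exact: measurable_itv.
move=> x /= /negP; rewrite in_itv /= negb_and -!ltNge => /orP[x0|x0].
- have [n nx] : exists n : nat, (- x) < n.+1%:R /\ n.+1%:R^-1 < - x.
    have xN : 0 < - x by rewrite oppr_gt0.
    near \oo => n; exists n; split.
      rewrite (@lt_trans _ _ n%:R) ?ltr_nat//.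
      by near: n; exact: nbhs_infty_gtr.
    by near: n; exact: near_invS_lt.
  exists n => //; left; rewrite /= in_itv /=; apply/andP; split;
    first by rewrite ltrNl nx.1.
  by rewrite lerNr ltW// nx.2.
- near \oo => n; exists n => //; right;
  rewrite /= in_itv /= x0 /= -lerBlDl ltW//.
  by near: n; exact: nbhs_infty_gtr.
Unshelve. all: by end_near. Qed.

Lemma kernel_measure_fin : (kernel_measure setT < +oo)%E.
Proof.
have -> : setT = (~` `[0, 2 * pi]) `|` `](-1), 2 * pi] :> set T.
  apply/seteqP; split => // x _ /=.
  case: (boolP (x \in `[0, 2 * pi]%R)) => [|xD]; last by left; apply/negP.
  rewrite !in_itv/= => /andP[x0 ->]; right; rewrite andbT.
  by rewrite (lt_le_trans _ x0)// ltrN10.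
apply: (le_lt_trans (measureU2 _ _ _)).
- by apply: measurableC; exact: measurable_itv.
- exact: measurable_itv.
- have e : kernel_measure `](-1), 2 * pi] =
  (right_cdf c (2 * pi) - right_cdf c (-1))%:E.
    apply: kernel_measure_itv.
    by rewrite (@le_trans _ _ 0) ?lerN10// mulr_ge0 ?pi_ge0.
  by rewrite [X in (X + _)%E]kernel_measure_support [X in (_ + X)%E]e add0e
    ltry.
Qed.

End kernel_measure.

(** * The matrix measure of a discrete analytic function *)

Section necessity.
Variables (R : realType) (p : nat) (f : nat -> nat -> 'M[R[i]]_p).
Local Notation T := (measurableTypeR R).
Hypotheses (fda : discrete_analytic f) (fsym : symmetric_fun f).
Hypothesis fpos : forall N, possemidef (finite_section f N).
Implicit Types v : 'I_p -> R[i].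

(** The scalar kernel v^* f v. *)
Definition compression v m n : R[i] := qform (f m n) v.

(** Positivity is that of the sections of f, tested on the vectors b_m v. *)
Lemma compression_positive_analytic v : positive_analytic (compression v).
Proof.
split.
- move=> [|N] b; first by rewrite big_ord0.
  have := (possemidef_finite_sectionP f N).1 (fpos N) (fun m j => b m * v j).
  congr (0 <= _); apply: eq_bigr => m _; apply: eq_bigr => n _.
  rewrite /compression /qform mulr_sumr; apply: eq_bigr => j _.
  rewrite mulr_sumr; apply: eq_bigr => k _; rewrite rmorphM /=; ring.
- move=> m n; rewrite /compression /qform !mulr_sumr -big_split -!sumrB
  big1// => j _.
  rewrite /= !mulr_sumr -big_split -!sumrB big1// => k _ /=.
  have /matrixP/(_ j k) := fda m n; rewrite !mxE => h.
  transitivity ((v j)^* * v k * (f m n j k + 'i%C * f m.+1 n j k -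
    'i%C * f m n.+1 j k - f m.+1 n.+1 j k)); first by ring.
  by rewrite h mulr0.
- move=> m; rewrite /compression fsym /qform rmorph_sum /= exchange_big.
  apply: eq_bigr => k _; rewrite rmorph_sum; apply: eq_bigr => j _ /=.
  by rewrite !mxE !rmorphM /= conjCK; ring.
Qed.

Definition compression_measure v : {measure set T -> \bar R} :=
  kernel_measure (compression_positive_analytic v).

(** Polarization of the measures of the kernels v^* f v; the factor 2 pi
    compensates the normalization of the moment formula. *)
Definition matrix_measure (A : set T) : 'M[R[i]]_p :=
  \matrix_(j, k) \sum_(s < 4) ((2 * pi)%:C * ((fourth_root R s)^* / 4)) *
    (fine (compression_measure (polar_vec R j k s) A))%:C.

(** By polarization, the kernel of v is a combination of those of the polar
    vectors. The distribution functions satisfy the same relation, hence so do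
    the measures of intervals and of all Borel sets. *)
Lemma qform_matrix_measure v A : measurable A ->
  qform (matrix_measure A) v =
    (2 * pi)%:C * (fine (compression_measure v A))%:C.
Proof.
move=> mA.
pose x (a : 'I_p * 'I_p * 'I_4) : R[i] :=
  (v a.1.1)^* * ((fourth_root R a.2)^* / 4) * v a.1.2.
pose w (a : 'I_p * 'I_p * 'I_4) := polar_vec R a.1.1 a.1.2 a.2.
have sum3 (F : 'I_p * 'I_p * 'I_4 -> R[i]) :
    \sum_a F a = \sum_j \sum_k \sum_s F (j, k, s).
  rewrite (eq_bigr (fun a => F (a.1.1, a.1.2, a.2))); last by move=> [[]].
  rewrite -(pair_bigA _ (fun jk s => F (jk.1, jk.2, s))) /=.
  by rewrite -(pair_bigA _ (fun j k => \sum_s F (j, k, s))).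
have cE : compression v = fun m n => \sum_a x a * compression (w a) m n.
  apply/funext => m; apply/funext => n; rewrite sum3 /x /w /=.
  apply: eq_bigr => j _; apply: eq_bigr => k _.
  rewrite [X in _ * X * _](polarization (f m n) j k) mulr_sumr mulr_suml.
  by apply: eq_bigr => s _; rewrite /compression; ring.
rewrite (@eq_comb_measure R _ (compression_measure v)
  (fun a => compression_measure (w a)) x) //.
- rewrite sum3 mulr_sumr; apply: eq_bigr => j _; rewrite mulr_sumr;
  apply: eq_bigr => k _.
  rewrite mxE mulr_sumr mulr_suml mulr_sumr; apply: eq_bigr => s _.
  by rewrite /x /w /=; ring.
- exact: kernel_measure_fin.
- by move=> a; exact: kernel_measure_fin.
- move=> a b ab.
  have mE u : (fine (compression_measure u `]a, b]))%:C =
      (right_cdf (compression u) b)%:C - (right_cdf (compression u) a)%:C.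
    by rewrite [X in fine X](kernel_measure_itv _ ab) -rmorphB.
  have cdfE t : (right_cdf (compression v) t)%:C =
      \sum_a0 x a0 * (right_cdf (compression (w a0)) t)%:C.
    apply: (right_cdf_sum _ (compression_positive_analytic v) _ cE) => a0.
    exact: compression_positive_analytic.
  apply: etrans (mE v) _.
  apply: etrans (congr2 (fun y z => y - z) (cdfE b) (cdfE a)) _.
  rewrite -sumrB; apply: eq_bigr => a0 _.
  by rewrite -mulrBr; congr (_ * _); exact/esym/mE.
Qed.

Lemma matrix_measure0 : matrix_measure set0 = 0.
Proof.
apply/matrixP => j k; rewrite !mxE big1// => s _.
by rewrite measure0 mulr0.
Qed.

Lemma matrix_measure_possemidef A : measurable A ->
    possemidef (matrix_measure A).
Proof.
move=> mA; apply/possemidefP => v; rewrite qform_matrix_measure// mulr_ge0//.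
  by rewrite ler0c mulr_ge0 ?pi_ge0.
by rewrite ler0c fine_ge0.
Qed.

Lemma matrix_measure_sigma_additive (F : (set T)^nat) :
  (forall n, measurable (F n)) -> trivIset setT F -> forall j k : 'I_p,
  (fun n => \sum_(0 <= l < n) matrix_measure (F l) j k : R[i]^o) @ \oo -->
  (matrix_measure (\bigcup_n F n) j k : R[i]^o).
Proof.
move=> mF tF j k; rewrite mxE.
rewrite (_ : (fun n => _) = fun n => \sum_(s < 4)
    ((2 * pi)%:C * ((fourth_root R s)^* / 4)) *
    (\sum_(0 <= l < n) fine
      (compression_measure (polar_vec R j k s) (F l)))%:C : R[i]^o).
  apply: cvg_sumC => s; apply: cvg_scaleC; apply: cvg_toC.
  by apply: fine_sigma_additive => //; exact: kernel_measure_fin.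
apply/funext => n; under eq_bigr do rewrite mxE.
rewrite exchange_big /=; apply: eq_bigr => s _.
by rewrite rmorph_sum mulr_sumr.
Qed.

Definition spectral_measure : posmxmeasure T R p :=
  PosMxMeasure matrix_measure0 matrix_measure_possemidef
    matrix_measure_sigma_additive.

Lemma spectral_measure_support : spectral_measure (~` `[0, 2 * pi]) = 0.
Proof.
apply/matrixP => j k; rewrite !mxE big1// => s _.
by rewrite [X in fine X]kernel_measure_support mulr0.
Qed.

(** The part of a grid interval outside [0, 2 pi] is null. *)
Lemma spectral_measure_grid n l j k :
  spectral_measure (`[0, 2 * pi] `&` `]grid R n l, grid R n l.+1]) j k =
  \sum_(s < 4) ((2 * pi)%:C * ((fourth_root R s)^* / 4)) *
    (right_cdf (compression (polar_vec R j k s)) (grid R n l.+1) -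
     right_cdf (compression (polar_vec R j k s)) (grid R n l))%:C.
Proof.
rewrite mxE; apply: eq_bigr => s _; congr (_ * _%:C).
set mu := compression_measure _; set I := `]grid R n l, grid R n l.+1]%classic.
have mI : measurable (I : set T) by exact: measurable_itv.
have mD : measurable (`[0, 2 * pi] : set T) by exact: measurable_itv.
have muDI : mu (`[0, 2 * pi] `&` I) = mu I.
  rewrite -[LHS]add0e setIC [RHS](measureDI mu mI mD); congr (_ + _)%E.
  apply/esym/eqP; rewrite eq_le measure_ge0 andbT.
  rewrite -[leRHS](kernel_measure_support
    (compression_positive_analytic (polar_vec R j k s))).
  apply: le_measure; rewrite ?inE; [exact: measurableD|exact: measurableC|].
  by move=> x [].
rewrite muDI [X in fine X](kernel_measure_itv _ (b := grid R n l.+1))//.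
exact: grid_nd.
Qed.

(** Riemann sums for M are the combinations, by polarization, of the sums
    for the distribution functions of the kernels v^* f v, whose limits are
    known. *)
Lemma spectral_measure_moments m n :
  f m n = ((2 * pi)^-1)%:C *:
    mxmeas_integral spectral_measure `[0, 2 * pi]
      (fun t => cosymbol t ^+ m * symbol t ^+ n).
Proof.
apply/matrixP => j k; rewrite mxE.
pose g t : R[i] := cosymbol t ^+ m * symbol t ^+ n; rewrite -/g.
have gb : bounded_lipschitzC g by apply: bounded_lipschitzCM;
  apply: bounded_lipschitzCX;
  [exact: bounded_lipschitzC_cosymbol|exact: bounded_lipschitzC_symbol].
suff -> : mxmeas_integral spectral_measure `[0, 2 * pi] g j k =
  (2 * pi)%:C * f m n j k.
  rewrite mulrA -rmorphM mulVf ?rmorph1 ?mul1r//.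
  by rewrite mulf_neq0 ?gt_eqF ?pi_gt0.
have h := @mxmeas_integral_cvg R p spectral_measure g j k gb.
apply: (cvg_unique (@norm_hausdorff _ (R[i]^o)) h).
have -> : (2 * pi)%:C * f m n j k = \sum_(s < 4)
    ((2 * pi)%:C * ((fourth_root R s)^* / 4)) *
    compression (polar_vec R j k s) m n.
  rewrite [X in _ * X](polarization (f m n) j k) mulr_sumr.
  by apply: eq_bigr => s _; exact: mulrA.
rewrite (_ : (fun L => _) = fun L => \sum_(s < 4)
  ((2 * pi)%:C * ((fourth_root R s)^* / 4)) *
  (\sum_(l < L.+2) g (grid R L l) *
    (right_cdf (compression (polar_vec R j k s)) (grid R L l.+1) -
     right_cdf (compression (polar_vec R j k s)) (grid R L l))%:C) : R[i]^o);
       last first.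
  apply/funext => L; under [RHS]eq_bigr do rewrite mulr_sumr.
  rewrite [RHS]exchange_big /=; apply: eq_bigr => l _.
  rewrite spectral_measure_grid mulr_sumr; apply: eq_bigr => s _; ring.
apply: cvg_sumC => s; apply: cvg_scaleC.
have wpa := compression_positive_analytic (polar_vec R j k s).
exact: right_cdf_riemann_cvgC wpa gb (weighted_sum_cvg wpa).
Qed.

End necessity.

Theorem theorem1p8 (R : realType) (p : nat) (hp : (1 <= p)%N)
    (f : nat -> nat -> 'M[R[i]]_p)
    (fda : discrete_analytic f) (fsym : symmetric_fun f) :
  (forall N : nat, possemidef (finite_section f N)) <->
  exists M : posmxmeasure (measurableTypeR R) R p,
    M (~` `[0, 2 * pi]) = 0 /\
    forall m n : nat,
      f m n = ((2 * pi)^-1)%:C *: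
        mxmeas_integral M `[0, 2 * pi]
          (fun t => ((Num.sqrt 2)%:C * expi (- t) - 'i%C) ^+ m
                    * ((Num.sqrt 2)%:C * expi t + 'i%C) ^+ n).
Proof.
split=> [fpos|[M [_ fM]]]; last exact: (moments_possemidef fM).
exists (spectral_measure fda fsym fpos); split.
  exact: spectral_measure_support.
exact: spectral_measure_moments.
Qed.
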